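(* For a trio $\mathcal F=(F_1,F_2,F_3)$ of finite sets of nonnegative integers (and parameters $\alpha,\beta,N$), the invariance $$\mathtt{H}_{\mathcal F,x}^{\alpha,\beta,N}=\epsilon\,\mathtt{H}_{I(\mathcal F),-x}^{-\alpha-\max F_1-\max F_2-2,\;-\beta-\max F_1+\max F_2,\;-N+\max F_1+\max F_3}$$ holds, where $\epsilon$ is the sign $(-1)^r$, with $r$ the degree (in $x$) of $\mathtt{H}_{\mathcal F,x}^{\alpha,\beta,N}$.
   Context: Write $(y)_n=y(y+1)\cdots(y+n-1)$ (with $(y)_0=1$) and $(y_1,\dots,y_m)_j=(y_1)_j\cdots(y_m)_j$. The Hahn polynomials are $$h_n^{\alpha,\beta,N}(x)=\frac{(-N)_n(\alpha+1)_n}{n!}\,{}_3F_2\!\left({-n,\,-x,\,n+\alpha+\beta+1\atop \alpha+1,\,-N};1\right),$$ that is, as polynomials, $$h_n^{\alpha,\beta,N}(x)=\frac1{n!}\sum_{j=0}^n\frac{(-n)_j(-x)_j(n+\alpha+\beta+1)_j(-N+j)_{n-j}(\alpha+1+j)_{n-j}}{j!}.$$ Let $\mathcal F=(F_1,F_2,F_3)$ be a trio of finite sets of nonnegative integers, where $F_i$ has $k_i$ elements, and put $k=k_1+k_2+k_3$, $\tilde k_1=k_1+k_2$, $\tilde k_2=k_1+k_3$, $\tilde k_3=k_2+k_3$, $\xi_1=\alpha+1$, $\xi_2=-N$, $\xi_3=-\beta-N$. Define $$D_{\mathcal F,x}^{\alpha,\beta,N}=\frac{\det A}{\prod_{s=1}^{3}\prod_{i=0}^{\tilde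 k_s-2}(\xi_s+x+i)^{\tilde k_s-i-1}},$$ where $A$ is the $k\times k$ matrix whose rows are, in this order (and in increasing order of $f$ within each set), with column index $1\le j\le k$: - for $f\in F_1$: entries $(\alpha+x+1,\,-N+x)_{j-1}\,h_f^{\alpha,\beta,N}(x+j-1)$; - for $f\in F_2$: entries $(\alpha+x+1,\,-\beta-N+x)_{j-1}\,h_f^{\alpha,-\beta,\beta+N}(x+j-1)$; - for $f\in F_3$: entries $(-N+x,\,-\beta-N+x)_{j-1}\,h_f^{-\beta-N-1,-\alpha-N-1,N}(x+j-1)$. $D_{\mathcal F,x}^{\alpha,\beta,N}$ is always a polynomial in $x$. Let $d_{\mathcal F}^{\alpha,\beta,N}$ be its leading coefficient (equal to $0$ if the polynomial is identically zero). The normalized quasi Casorati-Hahn determinant is $$\mathtt{H}_{\mathcal F,x}^{\alpha,\beta,N}=\frac{D_{\mathcal F,x}^{\alpha,\beta,N}}{d_{\mathcal F}^{\alpha,\beta,N}},$$ where, when $d_{\mathcal F}^{\alpha,\beta,N}=0$ (and hence $D_{\mathcal F,x}^{\alpha,\beta,N}=0$), one sets $\mathtt{H}_{\mathcal F,x}^{\alpha,\beta,N}=1$. The subscript $-x$ means evaluation of the polynomial at $-x$. For $I(\mathcal F)$, the numbers $k_i$, $\tilde k_i$, $k$ are those of the trio $I(\mathcal F)$ and the $\xi_i$ are formed from the corresponding parameters. For a finite set $F$ of nonnegative integers, $I(F)=\{0,1,\dots,\max F\}\setminus\{\max F-f:f\in F\}$, and $I(\mathcal F)=(I(F_1),I(F_2),I(F_3))$.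 Conventions: the determinant of an empty matrix and empty products are $1$; $\max\emptyset=-1$, so that $I(\emptyset)=\emptyset$.
   Formalization: The invariance is stated under the added condition that d_F and d_{I(F)} (at the transformed parameters) are both zero or both nonzero; otherwise it can fail, e.g. F=({0,2},∅,∅), α=0, β=−3, N=0, where the left side is 1 and the right side has degree 1. *)

(* Defs.v *)
From HB Require Import structures.
From mathcomp Require Import all_boot all_order all_algebra.
From mathcomp Require Import perm finmap ring.

Set Implicit Arguments.
Unset Strict Implicit.
Unset Printing Implicit Defensive.

Import Order.TTheory GRing.Theory Num.Theory.

Local Open Scope ring_scope.

Section Involution.
Local Open Scope fset_scope.

Definition nmax (F : {fset nat}) : nat := \max_(f <- F) f.

(* max F, with max of the empty set equal to -1. *)
Definition fmax (F : {fset nat}) : int :=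
  if F == fset0 then -1 else (nmax F)%:Z.

Definition invol (F : {fset nat}) : {fset nat} :=
  if F == fset0 then fset0
  else [fset m in iota 0 (nmax F).+1] `\` [fset (nmax F - f)%N | f in F].

End Involution.

Definition poch (R : nzRingType) (y : R) (n : nat) : R :=
  \prod_(i < n) (y + i%:R).

Section Hahn.
Variable K : numFieldType.
Implicit Types (a b N : K) (F : {fset nat}).

Definition hahn a b N (n : nat) : {poly K} :=
  (n`!%:R)^-1 *:
  \sum_(j < n.+1)
     ((poch (- n%:R) j * poch (n%:R + a + b + 1) j
       * poch (- N + j%:R) (n - j) * poch (a + 1 + j%:R) (n - j)) / j`!%:R)
     *: poch (- 'X) j.

(* The rows with index f in F, in increasing order of f: the entry in column
   j (counted from 0) is (x+u)_j (x+v)_j h_f(x+j). *)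
Definition qblock (u v : K) (h : nat -> {poly K}) F (k : nat) :
    'M[{poly K}]_(#|` F|%fset, k) :=
  \matrix_(i, j)
    (poch ('X + u%:P) j * poch ('X + v%:P) j
     * (h (nth 0%N (sort leq F) i) \Po ('X + (j%:R)%:P))).

Definition casorati_hahn_mx F1 F2 F3 a b N :
    'M[{poly K}]_(#|` F1|%fset + #|` F2|%fset + #|` F3|%fset) :=
  col_mx
    (col_mx
       (qblock (a + 1) (- N) (hahn a b N) F1 _)
       (qblock (a + 1) (- b - N) (hahn a (- b) (b + N)) F2 _))
    (qblock (- N) (- b - N) (hahn (- b - N - 1) (- a - N - 1) N) F3 _).

Definition casorati_den1 (xi : K) (kt : nat) : {poly K} :=
  \prod_(i < kt.-1) ('X + (xi + i%:R)%:P) ^+ (kt - i - 1).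

Definition casorati_hahn_den F1 F2 F3 a b N : {poly K} :=
  casorati_den1 (a + 1) (#|` F1|%fset + #|` F2|%fset)
  * casorati_den1 (- N) (#|` F1|%fset + #|` F3|%fset)
  * casorati_den1 (- b - N) (#|` F2|%fset + #|` F3|%fset).

(* D_{F,x}; the division is exact, see casorati_hahnK below. *)
Definition casorati_hahn F1 F2 F3 a b N : {poly K} :=
  \det (casorati_hahn_mx F1 F2 F3 a b N) %/ casorati_hahn_den F1 F2 F3 a b N.

(* d_F; lead_coef 0 = 0. *)
Definition casorati_hahn_lead F1 F2 F3 a b N : K :=
  lead_coef (casorati_hahn F1 F2 F3 a b N).

Definition ncasorati_hahn F1 F2 F3 a b N : {poly K} :=
  if casorati_hahn_lead F1 F2 F3 a b N == 0 then 1
  else (casorati_hahn_lead F1 F2 F3 a b N)^-1 *: casorati_hahn F1 F2 F3 a b N.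

Lemma casorati_den1E xi kt :
  casorati_den1 xi kt = \prod_(m < kt) poch ('X + xi%:P) m.
Proof.
rewrite /casorati_den1; elim: kt => [|[|n] IH]; first by rewrite !big_ord0.
  by rewrite big_ord0 big_ord_recl big_ord0 /poch big_ord0 mulr1.
rewrite [RHS]big_ord_recr -IH /= [in LHS]big_ord_recr /= /poch.
have -> : (n.+2 - n - 1)%N = 1%N by rewrite subSn // subSnn.
rewrite [in RHS]big_ord_recr /= mulrA; congr (_ * _); last first.
  by rewrite polyCD -polyC_natr addrA expr1.
rewrite -big_split; apply: eq_bigr => i _ /=.
have hi := ltn_ord i.
rewrite polyCD -[in RHS]polyC_natr addrA -exprSr; congr (_ ^+ _).
by rewrite -!subnDA !addn1 -subSn ?subSS // ltnS ltnW.
Qed.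

Lemma dvdp_poch (p : {poly K}) m n : (m <= n)%N -> poch p m %| poch p n.
Proof.
move=> le_mn; rewrite -(subnKC le_mn) /poch big_split_ord /=.
exact: dvdp_mulr.
Qed.

Lemma dvdp_prod_poch (p : {poly K}) (s : seq nat) : uniq s ->
  \prod_(m < size s) poch p m %| \prod_(m <- s) poch p m.
Proof.
move=> us; have ps := permEl (perm_sort leq s).
rewrite -(perm_big _ ps) /= -(size_sort leq s).
have : sorted ltn (sort leq s).
  by rewrite ltn_sorted_uniq_leq sort_uniq us sort_sorted //; apply: leq_total.
move: (sort leq s) => {us ps} {}s.
elim/last_ind: s => [|t x IH] st; first by rewrite big_ord0 big_nil.
rewrite size_rcons big_ord_recr -cats1 big_cat big_seq1 /=.
move: (st); rewrite -cats1 => /cat_sorted2[st' _].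
apply: dvdp_mul; first exact: IH.
apply: dvdp_poch.
have: uniq (rcons t x) by move: st; rewrite ltn_sorted_uniq_leq => /andP[].
rewrite rcons_uniq => /andP[_ ut].
have lt y : y \in t -> (y < x)%N.
  move=> yt; move: st; rewrite (sorted_pairwise ltn_trans) -cats1.
  by rewrite pairwise_cat => /and3P[/allrelP/(_ _ x yt)->]; rewrite ?mem_head.
rewrite -(size_iota 0 x); apply: uniq_leq_size => // y /lt.
by rewrite mem_iota.
Qed.

Lemma dvdp_den1 xi (S T : finType) (f : S -> nat) (g : T -> nat) :
  injective f -> injective g -> (forall i j, f i != g j) ->
  casorati_den1 xi (#|S| + #|T|)
  %| \prod_i poch ('X + xi%:P) (f i) * \prod_j poch ('X + xi%:P) (g j).
Proof.
move=> injf injg fg.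
pose s := map f (index_enum S) ++ map g (index_enum T).
have us : uniq s.
  rewrite cat_uniq !map_inj_uniq // !index_enum_uniq andbT /=.
  by apply/hasPn => _ /mapP[j _ ->]; apply/mapP => -[i _ /eqP]; rewrite eq_sym (negPf (fg i j)).
have -> : (#|S| + #|T|)%N = size s.
  by rewrite size_cat !size_map !cardT !enumT.
by have := dvdp_prod_poch ('X + xi%:P) us; rewrite casorati_den1E big_cat !big_map.
Qed.

Lemma dvdp_det_den F1 F2 F3 a b N :
  casorati_hahn_den F1 F2 F3 a b N %| \det (casorati_hahn_mx F1 F2 F3 a b N).
Proof.
rewrite /determinant; apply: (big_ind (fun p => casorati_hahn_den F1 F2 F3 a b N %| p)) => [|p q|s _]; first exact: dvdp0.
  exact: dvdp_add.
apply: dvdp_mull; rewrite !big_split_ord /=.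
under eq_bigr do rewrite col_mxEu col_mxEu mxE.
under [X in _ * X * _]eq_bigr do rewrite col_mxEu col_mxEd mxE.
under [X in _ * _ * X]eq_bigr do rewrite col_mxEd mxE.
rewrite !big_split /=.
set f1 := fun i : 'I_#|` F1|%fset => nat_of_ord (s (lshift _ (lshift _ i))).
set f2 := fun i : 'I_#|` F2|%fset => nat_of_ord (s (lshift _ (rshift _ i))).
set f3 := fun i : 'I_#|` F3|%fset => nat_of_ord (s (rshift _ i)).
have i1 : injective f1 by move=> i j /val_inj/perm_inj/lshift_inj/lshift_inj.
have i2 : injective f2 by move=> i j /val_inj/perm_inj/lshift_inj/rshift_inj.
have i3 : injective f3 by move=> i j /val_inj/perm_inj/rshift_inj.
have i12 i j : f1 i != f2 j.
  apply/eqP => /val_inj/perm_inj/lshift_inj/eqP.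
  by rewrite (eq_lrshift i j).
have i13 i j : f1 i != f3 j.
  by apply/eqP => /val_inj/perm_inj/eqP; rewrite eq_lrshift.
have i23 i j : f2 i != f3 j.
  by apply/eqP => /val_inj/perm_inj/eqP; rewrite eq_lrshift.
have d12 := dvdp_den1 (a + 1) i1 i2 i12.
have d13 := dvdp_den1 (- N) i1 i3 i13.
have d23 := dvdp_den1 (- b - N) i2 i3 i23.
rewrite !card_ord in d12 d13 d23.
have := dvdp_mul (dvdp_mul d12 d13) d23; rewrite /casorati_hahn_den.
set D := (X in X %| _); move=> dD.
set H1 := \prod_i (hahn _ _ _ _ \Po _).
set H2 := \prod_i (hahn _ _ _ _ \Po _).
set H3 := \prod_i (hahn _ _ _ _ \Po _).
apply: (dvdp_trans (dvdp_mulr (H1 * H2 * H3) dD)).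
rewrite [X in _ %| X](AC ((3*3)*3) (((1*4)*(2*7)*(5*8))*(3*6*9))).
exact: dvdpp.
Qed.

Lemma casorati_hahnK F1 F2 F3 a b N :
  casorati_hahn F1 F2 F3 a b N * casorati_hahn_den F1 F2 F3 a b N
  = \det (casorati_hahn_mx F1 F2 F3 a b N).
Proof. exact/divpK/dvdp_det_den. Qed.

End Hahn.

Section Degenerate.
Variable K : numFieldType.
Let F : {fset nat} := [fset 0%N; 2]%fset.

Lemma nmaxF : nmax F = 2.
Proof.
rewrite /nmax; apply/eqP; rewrite eqn_leq; apply/andP; split.
  by apply/bigmax_leqP_seq => i; rewrite !inE => /orP[]/eqP->.
by apply: (leq_bigmax_seq (F := id)) => //; rewrite !inE.
Qed.

Lemma Fn0 : (F == fset0) = false.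
Proof. by apply/negP => /eqP/fsetP/(_ 0%N); rewrite !inE. Qed.

Lemma fmax_F : fmax F = 2.
Proof. by rewrite /fmax Fn0 nmaxF. Qed.

Lemma fmax0 : fmax fset0 = -1.
Proof. by rewrite /fmax eqxx. Qed.

Lemma invol0 : invol fset0 = fset0.
Proof. by rewrite /invol eqxx. Qed.

Lemma invol_F : invol F = [fset 1%N]%fset.
Proof.
rewrite /invol Fn0 nmaxF; apply/fsetP => m; rewrite !inE /=.
case: (ltnP 2 m) => hm.
  by case: m hm => [|[|[|m]]] //; rewrite andbF.
case: m hm => [|[|[|m]]] //= _; rewrite ?andbT.
- by apply/negbTE/negPn/imfsetP; exists 2%N; rewrite ?inE.
- by apply/imfsetP => -[x /=]; rewrite !inE => /orP[]/eqP->.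
- by apply/negbTE/negPn/imfsetP; exists 0%N; rewrite ?inE.
Qed.

Lemma hahn2_0 : hahn 0 (-3) 0 2 = 0 :> {poly K}.
Proof.
rewrite /hahn big1 ?scaler0 // => -[j hj] _ /=.
rewrite addr0 -addrA (_ : -3 + 1 = - 2%:R) ?subrr; last first.
  by rewrite (natrD _ 2 1) opprD addrNK.
case: j hj => [|j] hj.
  have p0 : poch (- 0 + 0%:R) (2 - 0) = 0 :> K.
    by rewrite /poch big_ord_recl /= oppr0 !addr0 mul0r.
  by rewrite p0 !(mul0r, mulr0) scale0r.
have p0 : poch (0 : K) j.+1 = 0 by rewrite /poch big_ord_recl /= addr0 mul0r.
by rewrite p0 !(mul0r, mulr0) scale0r.
Qed.

Lemma DF0 : casorati_hahn F fset0 fset0 0 (-3) 0 = 0 :> {poly K}.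
Proof.
rewrite /casorati_hahn (_ : \det _ = 0) ?div0p //.
have h2 : (index 2%N (sort leq F) < #|` F|)%N.
  by rewrite -(size_sort leq) index_mem mem_sort !inE.
pose i := lshift #|` @fset0 nat|%fset (lshift #|` @fset0 nat|%fset (Ordinal h2)).
rewrite (expand_det_row _ i) big1 // => j _.
rewrite col_mxEu col_mxEu mxE /= nth_index ?mem_sort ?inE //.
by rewrite hahn2_0 comp_poly0 !(mulr0, mul0r).
Qed.

Lemma det_size1 (n : nat) (M : 'M[{poly K}]_n) p :
  n = 1%N -> (forall i j, M i j = p) -> \det M = p.
Proof. by move=> n1; case: _ / (esym n1) M => M HM; rewrite det_mx11 HM. Qed.

Lemma D1 a b N :
  casorati_hahn [fset 1%N]%fset fset0 fset0 a b N = hahn a b N 1 :> {poly K}.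
Proof.
have e1 : #|` [fset 1%N] |%fset = 1%N by rewrite cardfs1.
rewrite /casorati_hahn (_ : casorati_hahn_den _ _ _ _ _ _ = 1) ?divp1; last first.
  by rewrite /casorati_hahn_den /casorati_den1 !cardfs0 e1 /= !big_ord0 !mulr1.
apply: det_size1 => [|i j]; first by rewrite e1 cardfs0.
case: (split_ordP i) => [i' ->|[i' hi'] _]; last by exfalso; rewrite cardfs0 in hi'.
rewrite col_mxEu; case: (split_ordP i') => [[i2 hi2] ->|[i2 hi2] _]; last by exfalso; rewrite cardfs0 in hi2.
rewrite col_mxEu mxE /=.
have /eqP-> : nth 0%N (sort leq [fset 1%N]%fset) i2 == 1%N.
  by rewrite -(in_fset1 1%N) -(mem_sort leq) mem_nth ?size_sort.
have -> : nat_of_ord j = 0%N.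
  have k1 : (#|` [fset 1%N] | + #|` @fset0 nat| + #|` @fset0 nat| = 1)%N%fset.
    by rewrite e1 !cardfs0.
  by have := ltn_ord j; rewrite [X in (_ < X)%N]k1; case: (nat_of_ord j).
by rewrite /poch !big_ord0 !mul1r addr0 comp_polyXr.
Qed.

Lemma hahn1 a b N : hahn a b N 1 = (- N * (a + 1))%:P + (a + b + 2) *: 'X :> {poly K}.
Proof.
have pn (R : nzRingType) (y : R) : (poch y 0 = 1) * (poch y 1 = y).
  by rewrite /poch big_ord0 big_ord_recl big_ord0 /= addr0 mulr1.
rewrite /hahn big_ord_recl big_ord_recl big_ord0 /= !subn0 subnn !pn.
rewrite !(addr0, mul1r, mulr1, divr1, invr1, scale1r) alg_polyC; congr (_ + _).
rewrite mulN1r scaleNr scalerN opprK; congr (_ *: _); ring.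
Qed.

(* For ({0,2}, empty, empty), alpha = 0, beta = -3, N = 0 the determinant D_F is
   zero, so its normalization is the conventional 1, while the normalized
   determinant of the transformed data has degree 1. So the invariance needs
   the leading coefficients d_F and d_{I(F)} to vanish simultaneously. *)
Lemma invariance_degenerate :
  let H := ncasorati_hahn F fset0 fset0 (0 : K) (-3) 0 in
  H <> (-1) ^+ (size H).-1 *:
   (ncasorati_hahn (invol F) (invol fset0) (invol fset0)
     (- 0 - (fmax F)%:~R - (fmax fset0)%:~R - 2)
     (- -3 - (fmax F)%:~R + (fmax fset0)%:~R)
     (- 0 + (fmax F)%:~R + (fmax fset0)%:~R) \Po - 'X).
Proof.
move=> H.
have -> : H = 1 by rewrite /H /ncasorati_hahn /casorati_hahn_lead DF0 lead_coef0 eqxx.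
rewrite size_poly1 expr0 scale1r invol_F invol0 fmax_F fmax0.
set a := - 0 - _ - _ - _; set b := - -3 - _ + _; set N := - 0 + _ + _.
have hab : a + b + 2 = -1.
  rewrite /a /b -!pmulrn mulrNz; ring.
rewrite /ncasorati_hahn /casorati_hahn_lead D1 hahn1 hab.
set p := _%:P + _.
have sp : size p = 2.
  rewrite /p scaleN1r addrC size_polyDl size_polyN size_polyX //.
  by rewrite ltnS size_polyC_leq1.
rewrite lead_coef_eq0 -size_poly_eq0 sp /= => /(congr1 (fun p : {poly K} => size p)).
rewrite size_poly1 size_comp_poly2 ?size_polyN ?size_polyX //.
by rewrite size_scale ?sp // invr_eq0 lead_coef_eq0 -size_poly_eq0 sp.
Qed.
End Degenerate.

(* Main.v *)
(** Put a = alpha + 1, b = -N, c = -beta - N.  After division of the columns by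
    (x+a)_j (x+b)_j (x+c)_j, the rows of the matrix of D_F are the shifts
    phi(x+j) of h(x)/Gamma(x+q) with q = c, b, a for F_1, F_2, F_3: three
    families of eigenfunctions of one and the same second order difference
    operator.  Let C, B, A be max F_i + 1 for i = 1, 2, 3, let m = A + B + C,
    and let psi_r be the corresponding functions for the parameters
    2 - q - (m - count of q), taken at -x and with the index n of each family
    replaced by count - 1 - n.  With the Lagrange weights w_r, the inverse
    products of the differences of the m eigenvalues,
      T_d(x) = sum_r w_r phi_r(x+d) psi_r(x)
    vanishes for 0 <= d < m - 1 and is an explicit product for d = m - 1.  This
    is proved by induction on m: a contiguity relation removes one index from
    one family and reduces the claim to T_0 = 0, which follows by comparing two
    families or, for a single family, by a second contiguity relation that
    makes T_0 a constant.  Hence the matrices (phi_r(x+j)) and (psi_r(x-i)) are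
    inverse to each other up to a triangular factor, and Jacobi's theorem on
    complementary minors turns the rows r in F of the first into the rows
    outside F of the second, that is, D_F(x) into D_{I(F)}(-x) times the
    determinant of the full set of rows, which is constant.  This holds for
    generic parameters; the identity
    D_F(x) D_{I(F)}(-y) = D_F(y) D_{I(F)}(-x) then extends to all parameters
    because, up to denominators, it is polynomial in them, and it determines
    the normalized polynomials whenever neither determinant is zero. *)

Require Import Defs.
From mathcomp Require Import all_boot all_order all_algebra.
From mathcomp Require Import perm finmap ring zify.

Set Implicit Arguments.
Unset Strict Implicit.
Unset Printing Implicit Defensive.

Import Order.TTheory GRing.Theory Num.Theory.

Local Open Scope ring_scope.

(** * Pochhammer symbols and contiguity of Hahn polynomials *)

Section Pochhammer.
Variable R : nzRingType.
Implicit Types (y : R) (m n : nat).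

Lemma poch0 y : poch y 0 = 1.
Proof. by rewrite /poch big_ord0. Qed.

Lemma pochS y n : poch y n.+1 = poch y n * (y + n%:R).
Proof. by rewrite /poch big_ord_recr. Qed.

Lemma pochD y m n : poch y (m + n) = poch y m * poch (y + m%:R) n.
Proof.
rewrite /poch big_split_ord /=; congr (_ * _).
by apply: eq_bigr => i _; rewrite natrD addrA.
Qed.

Lemma pochSl y n : poch y n.+1 = y * poch (y + 1) n.
Proof. by rewrite -addn1 addnC pochD pochS poch0 mul1r addr0. Qed.

End Pochhammer.

Section Contiguity.
Variable K : numFieldType.
Implicit Types (a b c u v w x y : K).

Lemma horner_poch (p : {poly K}) n x : (poch p n).[x] = poch p.[x] n.
Proof.
elim: n => [|n IH]; first by rewrite !poch0 hornerC.
by rewrite !pochS hornerM IH hornerD -polyC_natr hornerC.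
Qed.

(** All integers are excluded, not only the poles at hand, so that the condition survives the
    integer shifts of the contiguity relations. *)
Definition nonint y := forall z : int, y != z%:~R.

Lemma nonint_neq0 y : nonint y -> y != 0.
Proof. by move/(_ 0). Qed.

Lemma nonintDz y (z : int) : nonint y -> nonint (y + z%:~R).
Proof. by move=> hy t; rewrite -subr_eq0 -addrA -intrB addr_eq0 -intrN; exact: hy. Qed.

Lemma nonintDn y (n : nat) : nonint y -> nonint (y + n%:R).
Proof. exact: (@nonintDz _ n). Qed.

Lemma nonintBn y (n : nat) : nonint y -> nonint (y - n%:R).
Proof. by move/(@nonintDz _ (- n%:Z)); rewrite intrN. Qed.

Lemma nonintN y : nonint y -> nonint (- y).
Proof. by move=> hy t; rewrite eqr_oppLR -intrN; exact: hy. Qed.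

Lemma poch_nonint y n : nonint y -> poch y n != 0.
Proof.
by move=> hy; apply/prodf_neq0 => i _; exact: nonint_neq0 (nonintDn i hy).
Qed.

Definition nhahn_coef u v w n j : K :=
  poch (- n%:R) j * poch (n%:R + u + v - w) j / (poch u j * poch v j * j`!%:R).

(* The polynomial 3F2(-n, -x, n+u+v-w; u, v; 1), that is, a Hahn polynomial with
   u = alpha + 1, v = -N, w = -beta - N, normalized by the value 1 at 0. *)
Definition nhahn u v w n : {poly K} :=
  \sum_(j < n.+1) nhahn_coef u v w n j *: poch (- 'X) j.

Lemma horner_nhahn u v w n x :
  (nhahn u v w n).[x] = \sum_(j < n.+1) nhahn_coef u v w n j * poch (- x) j.
Proof.
rewrite /nhahn horner_sum; apply: eq_bigr => j _.
by rewrite hornerZ horner_poch hornerN hornerX.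
Qed.

Lemma nhahn_coef_sym u v w n j : nhahn_coef u v w n j = nhahn_coef v u w n j.
Proof. by rewrite /nhahn_coef (addrAC _ u v) (mulrC (poch u j)). Qed.

Lemma nhahn_sym u v w n : nhahn u v w n = nhahn v u w n.
Proof. by apply: eq_bigr => j _; rewrite nhahn_coef_sym. Qed.

Lemma nhahn_coefS u v w n j : nonint u -> nonint v ->
  (u + j%:R) * (v + j%:R) * j.+1%:R * nhahn_coef u v w n j.+1 =
  (- n%:R + j%:R) * (n%:R + u + v - w + j%:R) * nhahn_coef u v w n j.
Proof.
move=> hu hv; rewrite /nhahn_coef !pochS factS natrM.
have uj := nonint_neq0 (nonintDn j hu); have vj := nonint_neq0 (nonintDn j hv).
have pu := poch_nonint j hu; have pv := poch_nonint j hv.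
have jf : (j`!%:R : K) != 0 by rewrite pnatr_eq0 -lt0n fact_gt0.
have j1 : (j.+1%:R : K) != 0 by rewrite pnatr_eq0.
by field; rewrite ?nat1r ?uj ?vj ?pu ?pv ?jf ?j1.
Qed.

Lemma nhahn0 u v w : nhahn u v w 0 = 1.
Proof.
rewrite /nhahn big_ord_recl big_ord0 /nhahn_coef !poch0 fact0 addr0 !mulr1 divr1.
by rewrite scale1r.
Qed.

Lemma nhahn_at0 u v w n : (nhahn u v w n).[0] = 1.
Proof.
rewrite horner_nhahn big_ord_recl big1 ?addr0 => [|j _].
  by rewrite /nhahn_coef !poch0 fact0 !mulr1 divr1.
by rewrite pochSl oppr0 mul0r mulr0.
Qed.

(** Since (-x-1)_(j+1) - (-x)_(j+1) = -(j+1) (-x)_j, differencing lowers each basis element and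
    turns its coefficient into one for [u + 1], [v + 1]. *)
Lemma nhahn_difference u v w n x : nonint u -> nonint v ->
  (nhahn u v w n.+1).[x + 1] - (nhahn u v w n.+1).[x] =
  n.+1%:R * (n.+1%:R + u + v - w) / (u * v)
    * (nhahn (u + 1) (v + 1) w n).[x].
Proof.
move=> hu hv; rewrite !horner_nhahn -sumrB big_ord_recl /= !poch0 subrr add0r.
rewrite mulr_sumr; apply: eq_bigr => j _.
rewrite /= /bump add1n.
have -> : nhahn_coef u v w n.+1 j.+1 =
    - (n.+1%:R * (n.+1%:R + u + v - w) / (u * v)) / j.+1%:R
     * nhahn_coef (u + 1) (v + 1) w n j.
  rewrite /nhahn_coef !(pochSl _ j) factS natrM.
  have -> : - n.+1%:R + 1 = - n%:R :> K by ring.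
  have -> : n.+1%:R + u + v - w + 1 = n%:R + (u + 1) + (v + 1) - w by ring.
  have pu := poch_nonint j (nonintDn 1 hu).
  have pv := poch_nonint j (nonintDn 1 hv).
  have jf : (j`!%:R : K) != 0 by rewrite pnatr_eq0 -lt0n fact_gt0.
  have j1 : (j.+1%:R : K) != 0 by rewrite pnatr_eq0.
  field; rewrite ?(nonint_neq0 hu) ?(nonint_neq0 hv) ?pu ?pv ?jf ?nat1r ?j1 //.
rewrite -mulrBr pochSl pochS.
have -> : - (x + 1) + 1 = - x by ring.
have j1 : (j.+1%:R : K) != 0 by rewrite pnatr_eq0.
by field; rewrite nat1r j1 !nonint_neq0.
Qed.

(** A first-order operator that keeps the index [n]. In the basis (-x)_j the coefficients combine
    through (v-w+j)(u+j) + (n-j)(n+u+v-w+j) = (n+u)(n+v-w), and the remaining factor u/(u+j)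
    accounts for the passage to [u + 1]. *)
Lemma nhahn_contiguous u v w n x : nonint u -> nonint v ->
  (x + v) * (nhahn u v w n).[x + 1] - (x + w) * (nhahn u v w n).[x] =
  (n%:R + u) * (n%:R + v - w) / u * (nhahn (u + 1) v (w + 1) n).[x].
Proof.
move=> hu hv; rewrite !horner_nhahn !mulr_sumr.
pose t := nhahn_coef u v w n; pose e := poch (- x).
(* Up to sign, the part of (x+v)(-x-1)_j that falls to (-x)_(j-1). It vanishes at j = 0 and j = n+1,
   so its sum may be reindexed. *)
pose g j := t j * j%:R * (v + j%:R - 1) * poch (- x) j.-1.
have -> : \sum_(j < n.+1) (x + v) * (nhahn_coef u v w n j * poch (- (x + 1)) j) =
  \sum_(j < n.+1) ((x + w) * (t j * e j) + (v - w + j%:R) * t j * e j)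
   - \sum_(j < n.+1) g j.
  rewrite -sumrB; apply: eq_bigr => -[[|j] hj] _ /=; rewrite /g /e.
    by rewrite !poch0 /t; ring.
  rewrite /= [in LHS]pochSl (_ : - (x + 1) + 1 = - x) ?pochS; last by ring.
  by rewrite -/t /t; ring.
rewrite big_split /= addrAC [X in X - _]addrC addKr.
have -> : \sum_(j < n.+1) g j = \sum_(j < n.+1) g j.+1.
  have g0 : g 0%N = 0 by rewrite /g mulr0 !mul0r.
  have gn : g n.+1 = 0.
    by rewrite /g /t /nhahn_coef pochS addNr !(mulr0, mul0r).
  transitivity (\sum_(j < n.+2) g j); first by rewrite [RHS]big_ord_recr /= gn addr0.
  by rewrite big_ord_recl g0 add0r.
rewrite -sumrB; apply: eq_bigr => j _; rewrite /g /=.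
have un0 := nonint_neq0 hu.
have uj := nonint_neq0 (nonintDn j hu); have vj := nonint_neq0 (nonintDn j hv).
have -> : t j.+1 * j.+1%:R * (v + j.+1%:R - 1) =
    (- n%:R + j%:R) * (n%:R + u + v - w + j%:R) * t j / (u + j%:R).
  apply: (mulIf uj); rewrite mulfVK // -nhahn_coefS // -/t -natr1 -/(t j.+1).
  by ring.
have -> : nhahn_coef (u + 1) v (w + 1) n j = u / (u + j%:R) * t j.
  rewrite /t /nhahn_coef (_ : n%:R + (u + 1) + v - (w + 1) = n%:R + u + v - w);
    last by ring.
  have pu1 := poch_nonint j (nonintDn 1 hu); have pu := poch_nonint j hu.
  have pv := poch_nonint j hv.
  have jf : (j`!%:R : K) != 0 by rewrite pnatr_eq0 -lt0n fact_gt0.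
  have e1 : poch u j * (u + j%:R) = u * poch (u + 1) j by rewrite -pochS pochSl.
  have -> : poch u j = u * poch (u + 1) j / (u + j%:R) by rewrite -e1 mulfK.
  by field; rewrite pu1 pv jf uj un0.
by rewrite /e; field; rewrite uj un0.
Qed.

End Contiguity.

(** * Lagrange weights and the bilinear pairing *)

Section Pairing.
Variable K : numFieldType.
Implicit Types (a b c u v w x y : K) (A B C U V W d n : nat).

(* The families with gauges w, v, u have W, V, U members, and the eigenvalue of
   index n in family w exceeds that of index l by (n-l)(n+l+u+v-w) in family w,
   by (n-l+v-w)(n+l+u) in family v and by (n-l+u-w)(n+l+v) in family u. *)
Definition lagrange_coef u v w U V W n : K :=
  (\prod_(l < W | l != n :> nat)
      ((n%:R - l%:R) * (n%:R + l%:R + u + v - w))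
   * \prod_(l < V) ((n%:R - l%:R + v - w) * (n%:R + l%:R + u))
   * \prod_(l < U) ((n%:R - l%:R + u - w) * (n%:R + l%:R + v)))^-1.

Lemma lagrange_coef_sym u v w U V W n :
  lagrange_coef u v w U V W n = lagrange_coef v u w V U W n.
Proof.
rewrite /lagrange_coef [in RHS]mulrAC; congr (_ * _ * _)^-1.
by apply: eq_bigr => l _; congr (_ * _); ring.
Qed.

(** The eigenvalue difference to index 0 of family [w] cancels that node; the other indices of the
    family move down by one, which raising [u] and [v] compensates. *)
Lemma lagrange_coef_drop_first u v w U V W n : nonint (u + v - w) ->
  lagrange_coef u v w U V W.+1 n.+1 * (n.+1%:R * (n.+1%:R + u + v - w)) =
  lagrange_coef (u + 1) (v + 1) w U V W n.
Proof.
move=> hs.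
have n0 : n.+1%:R * (n.+1%:R + u + v - w) != 0.
  rewrite mulf_neq0 ?pnatr_eq0 // nonint_neq0 //.
  have -> : n.+1%:R + u + v - w = u + v - w + n.+1%:R by ring.
  exact: nonintDn.
apply: (mulIf (invr_neq0 n0)); rewrite mulfK // /lagrange_coef -invfM; congr _^-1.
have -> : \prod_(l < W.+1 | l != n.+1 :> nat)
      ((n.+1%:R - l%:R) * (n.+1%:R + l%:R + u + v - w)) =
    n.+1%:R * (n.+1%:R + u + v - w) * \prod_(l < W | l != n :> nat)
      ((n%:R - l%:R) * (n%:R + l%:R + (u + 1) + (v + 1) - w)) :> K.
  rewrite big_mkcond big_ord_recl /= subr0 addr0 -big_mkcond; congr (_ * _).
  by apply: eq_big => l; rewrite /= /bump add1n // -!natr1 => _; ring.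
rewrite [RHS]mulrC -!mulrA; do 3!congr (_ * _).
by congr (_ * _); apply: eq_bigr => l _; rewrite -!natr1; ring.
Qed.

Lemma lagrange_coef_drop_last u v w U V W n : nonint (u + v - w) -> (n < W)%N ->
  lagrange_coef u v w U V W.+1 n * ((n%:R - W%:R) * (n%:R + W%:R + u + v - w)) =
  lagrange_coef u v w U V W n.
Proof.
move=> hs nW.
have n0 : (n%:R - W%:R) * (n%:R + W%:R + u + v - w) != 0.
  apply: mulf_neq0; first by rewrite subr_eq0 eqr_nat ltn_eqF.
  apply: nonint_neq0.
  have -> : n%:R + W%:R + u + v - w = u + v - w + (n + W)%:R by ring.
  exact: nonintDn.
apply: (mulIf (invr_neq0 n0)); rewrite mulfK // /lagrange_coef -invfM; congr _^-1.
rewrite big_mkcond big_ord_recr /= -big_mkcond gtn_eqF //=; ring.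
Qed.

(** The node removed here is index 0 of family [v], seen from family [w]: raising [u] and [w]
    compensates the shift of the remaining indices of family [v], while [n] stays. *)
Lemma lagrange_coef_drop_cross u v w U V W n : nonint (v - w) -> nonint u ->
  lagrange_coef u v w U V.+1 W n * ((n%:R + u) * (n%:R + v - w)) =
  lagrange_coef (u + 1) v (w + 1) U V W n.
Proof.
move=> hs hu.
have n0 : (n%:R + u) * (n%:R + v - w) != 0.
  rewrite -addrA [_ + u]addrC [_ + (v - w)]addrC.
  by apply: mulf_neq0; apply: nonint_neq0; apply: nonintDn.
apply: (mulIf (invr_neq0 n0)); rewrite mulfK // /lagrange_coef -invfM; congr _^-1.
rewrite big_ord_recl /= subr0 addr0 [in RHS]mulrC.
rewrite [X in X * _](_ : _ = 
   ((n%:R + u) * (n%:R + v - w)) * (\prod_(l < W | l != n :> nat)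
      ((n%:R - l%:R) * (n%:R + l%:R + u + v - w)) * \prod_(i < V)
   ((n%:R - (lift ord0 i)%:R + v - w) * (n%:R + (lift ord0 i)%:R + u)))); last by ring.
rewrite -[LHS]mulrA; congr (_ * (_ * _ * _)); apply: eq_bigr => l _.
- by congr (_ * _); ring.
- by rewrite /= /bump add1n -natr1; congr (_ * _); ring.
- by congr (_ * _); ring.
Qed.

(** Besides the parameters, these are the forms whose integer translates occur as factors of the
    eigenvalue differences. *)
Definition generic u v w :=
  [/\ [/\ nonint u, nonint v & nonint w],
      [/\ nonint (u - v), nonint (u - w) & nonint (v - w)]
    & [/\ nonint (u + v - w), nonint (u + w - v) & nonint (v + w - u)]].

Lemma generic_swapl u v w : generic u v w -> generic v u w.
Proof.
case=> -[hu hv hw] [huv huw hvw] [h1 h2 h3]; do 2!split => //.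
  by rewrite -opprB; apply: nonintN.
by rewrite (addrC v).
Qed.

Lemma generic_swapr u v w : generic u v w -> generic u w v.
Proof.
case=> -[hu hv hw] [huv huw hvw] [h1 h2 h3]; do 2!split => //.
  by rewrite -opprB; apply: nonintN.
by rewrite (addrC w).
Qed.

Lemma nonint_shift y z (k : int) : y = z + k%:~R -> nonint z -> nonint y.
Proof. by move=> ->; apply: nonintDz. Qed.

Lemma generic_shift u v w : generic u v w -> generic (u + 1) (v + 1) w.
Proof.
case=> -[hu hv hw] [huv huw hvw] [h1 h2 h3]; do 2!split => //.
- exact: nonint_shift (erefl (u + 1%:~R)) hu.
- exact: nonint_shift (erefl (v + 1%:~R)) hv.
- by apply: (@nonint_shift _ (u - v) 0) => //; ring.
- by apply: (@nonint_shift _ (u - w) 1) => //; ring.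
- by apply: (@nonint_shift _ (v - w) 1) => //; ring.
- by apply: (@nonint_shift _ (u + v - w) 2) => //; ring.
- by apply: (@nonint_shift _ (u + w - v) 0) => //; ring.
- by apply: (@nonint_shift _ (v + w - u) 0) => //; ring.
Qed.

(* The parameter of the transformed data corresponding to q, when n is the total
   size of the two families whose gauge is not q. *)
Definition dual_param q n : K := 2 - q - n%:R.

Lemma generic_dual_param u v w U V W : generic u v w ->
  generic (dual_param u U) (dual_param v V) (dual_param w W).
Proof.
case=> -[hu hv hw] [huv huw hvw] [h1 h2 h3]; rewrite /dual_param; do 2!split => //.
- by apply: (@nonint_shift _ (- u) (2 - U%:Z));
  [ring | exact: nonintN].
- by apply: (@nonint_shift _ (- v) (2 - V%:Z));
  [ring | exact: nonintN].
- by apply: (@nonint_shift _ (- w) (2 - W%:Z));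
  [ring | exact: nonintN].
- by apply: (@nonint_shift _ (- (u - v)) (V%:Z - U%:Z));
  [ring | exact: nonintN].
- by apply: (@nonint_shift _ (- (u - w)) (W%:Z - U%:Z));
  [ring | exact: nonintN].
- by apply: (@nonint_shift _ (- (v - w)) (W%:Z - V%:Z));
  [ring | exact: nonintN].
- by apply: (@nonint_shift _ (- (u + v - w)) (2 - U%:Z - V%:Z + W%:Z));
  [ring | exact: nonintN].
- by apply: (@nonint_shift _ (- (u + w - v)) (2 - U%:Z - W%:Z + V%:Z));
  [ring | exact: nonintN].
- by apply: (@nonint_shift _ (- (v + w - u)) (2 - V%:Z - W%:Z + U%:Z));
  [ring | exact: nonintN].
Qed.

(** * The share of one family in T_d and its recursions *)

Definition block_sum u v w U V W d : {poly K} :=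
  \sum_(n < W) lagrange_coef u v w U V W n *:
    ((nhahn u v w n \Po ('X + d%:R%:P))
     * (nhahn (dual_param u (V + W)) (dual_param v (U + W)) (dual_param w (U + V)) (W.-1 - n)
        \Po - 'X)).

(* The contribution of family w to T_d, cleared of denominators; the Gamma
   quotient of the two gauges becomes (x+w-1)_(U+V). *)
Definition block_pairing u v w U V W d : {poly K} :=
  ((w - 1) / poch (w - 1) (U + V)) *:
   (poch ('X + (u - 1)%:P) d.+1 * poch ('X + (v - 1)%:P) d.+1
    * poch ('X + (w - 1)%:P) (U + V) * block_sum u v w U V W d).

Lemma horner_block_sum u v w U V W d x : (block_sum u v w U V W d).[x] =
  \sum_(n < W) lagrange_coef u v w U V W n *
    ((nhahn u v w n).[x + d%:R]
     * (nhahn (dual_param u (V + W)) (dual_param v (U + W)) (dual_param w (U + V))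
          (W.-1 - n)).[- x]).
Proof.
rewrite horner_sum; apply: eq_bigr => n _.
by rewrite hornerZ hornerM !horner_comp hornerD hornerX hornerC hornerN hornerX.
Qed.

Lemma horner_block_pairing u v w U V W d x : (block_pairing u v w U V W d).[x] =
  (w - 1) / poch (w - 1) (U + V) *
   (poch (x + (u - 1)) d.+1 * poch (x + (v - 1)) d.+1
    * poch (x + (w - 1)) (U + V) * (block_sum u v w U V W d).[x]).
Proof. by rewrite hornerZ !hornerM !horner_poch !hornerD !hornerX !hornerC. Qed.

Lemma block_sum_sym u v w U V W d : block_sum u v w U V W d = block_sum v u w V U W d.
Proof.
apply: eq_bigr => n _; rewrite lagrange_coef_sym nhahn_sym; congr (_ *: (_ * (_ \Po _))).
by rewrite nhahn_sym (addnC U V).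
Qed.

Lemma block_pairing_sym u v w U V W d :
  block_pairing u v w U V W d = block_pairing v u w V U W d.
Proof.
by rewrite /block_pairing block_sum_sym (addnC U V) (mulrC (poch _ d.+1) (poch _ d.+1)).
Qed.

(** Differencing kills the constant polynomial of index 0. The dual polynomials of the other terms
    are untouched, since raising a parameter offsets the smaller count in [dual_param]. *)
Lemma block_sum_drop_first u v w U V W d x : generic u v w ->
  (block_sum u v w U V W.+1 d.+1).[x] = (block_sum u v w U V W.+1 d).[x]
   + (block_sum (u + 1) (v + 1) w U V W d).[x] / (u * v).
Proof.
case=> -[hu hv hw] _ [hs _ _]; rewrite !horner_block_sum [RHS]addrC.
apply/eqP; rewrite -subr_eq -sumrB big_ord_recl /= !nhahn0 !hornerC subrr add0r.
rewrite mulr_suml; apply/eqP; apply: eq_bigr => n _; rewrite /= /bump add1n.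
have -> : x + d.+1%:R = x + d%:R + 1 by ring.
rewrite -mulrBr -mulrBl nhahn_difference //
  -(lagrange_coef_drop_first _ _ _ _ hs) subnS predn_sub.
have -> : dual_param (u + 1) (V + W) = dual_param u (V + W.+1) by rewrite /dual_param; ring.
have -> : dual_param (v + 1) (U + W) = dual_param v (U + W.+1) by rewrite /dual_param; ring.
by field; rewrite !nonint_neq0.
Qed.

Lemma block_sum_drop_cross u v w U V W d x : generic u v w ->
  (x + v + d%:R) * (block_sum u v w U V.+1 W d.+1).[x] =
  (x + w + d%:R) * (block_sum u v w U V.+1 W d).[x]
   + (block_sum (u + 1) v (w + 1) U V W d).[x] / u.
Proof.
case=> -[hu hv hw] [_ _ hvw] _; rewrite !horner_block_sum [RHS]addrC.
apply/eqP; rewrite -subr_eq !mulr_sumr -sumrB.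
rewrite mulr_suml; apply/eqP; apply: eq_bigr => n _.
have -> : x + d.+1%:R = x + d%:R + 1 by ring.
have -> : dual_param (u + 1) (V + W) = dual_param u (V.+1 + W) by rewrite /dual_param; ring.
have -> : dual_param (w + 1) (U + V) = dual_param w (U + V.+1) by rewrite /dual_param; ring.
rewrite -(lagrange_coef_drop_cross _ _ _ _ hvw hu).
have := nhahn_contiguous w n (x + d%:R) hu hv.
set p := (nhahn u v w n).[_ + 1]; set q := (nhahn u v w n).[_] => e.
set l := lagrange_coef _ _ _ _ _ _ _; set r := (nhahn _ _ _ _).[- x].
transitivity (l * r * ((x + d%:R + v) * p - (x + d%:R + w) * q)); first by ring.
by rewrite e; field; rewrite !nonint_neq0.
Qed.

Lemma poch_shift x u n :
  poch (x + (u - 1)) n * (x + u + n%:R - 1) = (x + u - 1) * poch (x + (u + 1 - 1)) n.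
Proof.
have -> : x + u + n%:R - 1 = x + (u - 1) + n%:R by ring.
by rewrite -pochS pochSl; congr (_ * poch _ _); ring.
Qed.

(** After clearing denominators, this recursion and the next have one shape, with factors depending
    only on the two parameters that are raised; hence the three families can be added. *)
Lemma block_pairing_drop_first u v w U V W d x : generic u v w ->
  (block_pairing u v w U V W.+1 d.+1).[x] =
  (x + u + d%:R) * (x + v + d%:R) * (block_pairing u v w U V W.+1 d).[x]
   + (x + u - 1) * (x + v - 1) / (u * v)
     * (block_pairing (u + 1) (v + 1) w U V W d).[x].
Proof.
move=> g; rewrite !horner_block_pairing block_sum_drop_first // !(pochS _ d.+1).
have e1 := poch_shift x u d.+1; have e2 := poch_shift x v d.+1.
set p := poch (x + (u - 1)) _ in e1 *; set q := poch (x + (v - 1)) _ in e2 *.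
have -> : x + (u - 1) + d.+1%:R = x + u + d.+1%:R - 1 by ring.
have -> : x + (v - 1) + d.+1%:R = x + v + d.+1%:R - 1 by ring.
set r := poch (x + (w - 1)) (U + V); set S0 := _.[x]; set S1 := _.[x].
set k := (w - 1) / _; set p' := _ * (_ - 1) in e1 *; set q' := _ * (_ - 1) in e2 *.
transitivity (k * (p' * q' * r) * S0 + k * r * p' * q' * (S1 / (u * v))).
  by ring.
congr (_ + _); first by rewrite /p' /q'; ring.
by rewrite e1 e2; ring.
Qed.

Lemma block_pairing_drop_cross u v w U V W d x : generic u v w ->
  (block_pairing u v w U V.+1 W d.+1).[x] =
  (x + u + d%:R) * (x + w + d%:R) * (block_pairing u v w U V.+1 W d).[x]
   + (x + u - 1) * (x + w - 1) / (u * w)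
     * (block_pairing (u + 1) v (w + 1) U V W d).[x].
Proof.
move=> g; have [[hu hv hw] _ _] := g; rewrite !horner_block_pairing !(pochS _ d.+1).
have := block_sum_drop_cross U V W d x g.
set S0 := (block_sum _ _ _ _ _ _ d).[x]; set S1 := (block_sum _ _ _ _ _ _ d).[x].
set S2 := (block_sum _ _ _ _ _ _ _).[x] => e.
have e1 := poch_shift x u d.+1.
set p := poch (x + (u - 1)) _ in e1 *; set q := poch (x + (v - 1)) _.
have -> : x + (u - 1) + d.+1%:R = x + u + d.+1%:R - 1 by ring.
have -> : x + (v - 1) + d.+1%:R = x + v + d%:R by ring.
rewrite addnS !(pochSl _ (U + V)).
have -> : w - 1 + 1 = w by ring.
have -> : w + 1 - 1 = w by ring.
have -> : x + (w - 1) + 1 = x + w by ring.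
have w0 := nonint_neq0 hw; have pw := poch_nonint (U + V) hw.
have w1 : w - 1 != 0 by exact: nonint_neq0 (nonintBn 1 hw).
set P := poch w _ in pw *; set r := poch _ (U + V).
transitivity (P^-1 * (x + (w - 1)) * r * q * (p * (x + u + d.+1%:R - 1)) *
  ((x + v + d%:R) * S2)); first by field; rewrite w1 pw.
rewrite e mulrDr; congr (_ + _); first by field; rewrite pw w1.
by rewrite e1; field; rewrite pw w0 nonint_neq0.
Qed.

(** * The full pairing T_d and its value *)

Definition pairing a b c A B C d : {poly K} :=
  block_pairing a b c A B C d + block_pairing a c b A C B d + block_pairing b c a B C A d.

Lemma horner_pairing a b c A B C d x : (pairing a b c A B C d).[x] =
  (block_pairing a b c A B C d).[x] + (block_pairing a c b A C B d).[x]
  + (block_pairing b c a B C A d).[x].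
Proof. by rewrite /pairing 2!hornerD. Qed.

Lemma pairing_swapl a b c A B C d : pairing a b c A B C d = pairing b a c B A C d.
Proof. by rewrite /pairing block_pairing_sym addrAC. Qed.

Lemma pairing_swapr a b c A B C d : pairing a b c A B C d = pairing a c b A C B d.
Proof.
rewrite /pairing [block_pairing c b _ _ _ _ _]block_pairing_sym.
by rewrite (addrC (block_pairing a b c _ _ _ _)).
Qed.

Lemma poly_natP (p q : {poly K}) : (forall n : nat, p.[n%:R] = q.[n%:R]) -> p = q.
Proof.
move=> e; apply/eqP; rewrite -subr_eq0; apply/negPn/negP => pq0.
have := @max_poly_roots _ (p - q) [seq n%:R | n <- iota 0 (size (p - q))] pq0.
rewrite size_map size_iota ltnn => H; suff: false by []; apply: H.
  by apply/allP => _ /mapP[n _ ->]; rewrite /root !hornerE e subrr.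
by rewrite map_inj_uniq ?iota_uniq // => m n /eqP; rewrite eqr_nat => /eqP.
Qed.

(** Index 0 of family [c] is removed: that family follows [block_pairing_drop_first], the two others
    [block_pairing_drop_cross]. *)
Lemma pairing_step a b c A B C d : generic a b c ->
  pairing a b c A B C.+1 d.+1 =
  ('X + (a + d%:R)%:P) * ('X + (b + d%:R)%:P) * pairing a b c A B C.+1 d
   + (a * b)^-1 *: (('X + (a - 1)%:P) * ('X + (b - 1)%:P)
                    * pairing (a + 1) (b + 1) c A B C d).
Proof.
move=> g; have g' := generic_swapr g.
have g'' := generic_swapr (generic_swapl g).
have [[ha hb hc] _ _] := g.
apply: poly_natP => n; set x := n%:R.
have E (k a1 b1 a2 b2 y : K) (T T' : {poly K}) :
    (('X + a1%:P) * ('X + b1%:P) * T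
     + k *: (('X + a2%:P) * ('X + b2%:P) * T')).[y] =
    (y + a1) * (y + b1) * T.[y] + k * ((y + a2) * (y + b2) * T'.[y]).
  by rewrite !hornerE.
rewrite E !horner_pairing.
rewrite block_pairing_drop_first // !block_pairing_drop_cross //.
by field; rewrite !nonint_neq0.
Qed.

Lemma poly_periodic (p : {poly K}) :
  (forall x, p.[x + 1] = p.[x]) -> p = (p.[0])%:P.
Proof.
move=> e; apply: poly_natP => n; rewrite hornerC.
by elim: n => // n IH; rewrite -natr1 e IH.
Qed.

Definition gauge q M : {poly K} := poch ('X + (q - 1)%:P) M.
(** Chosen so that [gauge_const q M] times [gauge q M], divided by x + q - 1, is 1 at x = 0, like
    the polynomials [nhahn]. *)
Definition gauge_const q M : K := (q - 1) / poch (q - 1) M.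

(** A divided difference of the constant 1. The factors that remove the first and the last node
    differ by a nonzero constant, and both reduced sums are equal by induction; so the constant
    times the sum is 0. *)
Lemma lagrange_coef_sum W u v w : generic u v w ->
  \sum_(n < W) lagrange_coef u v w 0 0 W n = (W == 1%N)%:R.
Proof.
elim: W u v w => [|W IH] u v w g; first by rewrite big_ord0.
have [[hu hv hw] _ [hs _ _]] := g.
case: W => [|W] in IH *.
  by rewrite big_ord1 /lagrange_coef !big_ord0 big_mkcond big_ord1 eqxx !mulr1 invr1.
pose L n := lagrange_coef u v w 0 0 W.+2 n; set s := u + v - w.
have e1 : \sum_(n < W.+2) L n * (n%:R * (n%:R + s)) = (W.+1 == 1)%:R.
  rewrite big_ord_recl /= mul0r mulr0 add0r -(IH _ _ _ (generic_shift g)).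
  apply: eq_bigr => n _; rewrite /L /= /bump add1n -(lagrange_coef_drop_first _ _ _ _ hs).
  by rewrite /s !addrA.
have e2 : \sum_(n < W.+2) L n * ((n%:R - W.+1%:R) * (n%:R + W.+1%:R + s))
    = (W.+1 == 1)%:R.
  rewrite big_ord_recr /= subrr mul0r mulr0 addr0 -(IH _ _ _ g).
  apply: eq_bigr => n _; rewrite /L -(lagrange_coef_drop_last 0 0 hs (ltn_ord n)).
  by rewrite /s !addrA. 
have W0 : W.+1%:R * (W.+1%:R + s) != 0 :> K.
  by rewrite mulf_neq0 ?pnatr_eq0 // addrC; apply/nonint_neq0/(nonintDn _ hs).
apply: (mulfI W0); rewrite /= mulr0 mulr_sumr.
transitivity (\sum_(n < W.+2) (L n * (n%:R * (n%:R + s)) -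
   L n * ((n%:R - W.+1%:R) * (n%:R + W.+1%:R + s)))).
  by apply: eq_bigr => n _; rewrite /L; ring.
by rewrite sumrB e1 e2 subrr.
Qed.

(** The mirror image of [block_sum_drop_first]: the difference acts on the dual polynomials, and the
    one paired with the last index is constant. *)
Lemma block_sum_drop_last u v w U V W d x : generic u v w ->
  (block_sum u v w U V W.+1 d.+1).[x - 1] = (block_sum u v w U V W.+1 d).[x]
   + (block_sum u v w U V W d).[x] / (dual_param u (V + W.+1) * dual_param v (U + W.+1)).
Proof.
move=> g; have [_ _ [hs _ _]] := g.
have [[hu hv hw] _ _] := generic_dual_param (V + W.+1) (U + W.+1) (U + V) g.
rewrite !horner_block_sum [RHS]addrC; apply/eqP; rewrite -subr_eq -sumrB big_ord_recr /=.
rewrite subnn !nhahn0 !hornerC.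
have -> : x - 1 + d.+1%:R = x + d%:R by ring.
rewrite subrr addr0 mulr_suml; apply/eqP; apply: eq_bigr => n _ /=.
have nW := ltn_ord n.
rewrite -(lagrange_coef_drop_last U V hs nW).
have -> : (W - n)%N = (W.-1 - n).+1 by lia.
have -> : - (x - 1) = - x + 1 by ring.
rewrite -mulrBr -mulrBr nhahn_difference //.
have -> : dual_param u (V + W) = dual_param u (V + W.+1) + 1 by rewrite /dual_param; ring.
have -> : dual_param v (U + W) = dual_param v (U + W.+1) + 1 by rewrite /dual_param; ring.
have -> : (W.-1 - n).+1%:R = W%:R - n%:R :> K.
  by rewrite -natrB ?(ltnW nW) //; congr (_ %:R); lia.
set p := _.[_]; set q := _.[_]; set l := lagrange_coef _ _ _ _ _ _ _.
set fu := dual_param u _ in hu *; set fv := dual_param v _ in hv *.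
have -> : W%:R - n%:R + fu + fv - dual_param w (U + V)
    = - (n%:R + W%:R + u + v - w) by rewrite /fu /fv /dual_param; ring.
by field; rewrite !nonint_neq0.
Qed.

Lemma block_sum_pure u v w W d : generic u v w -> (d < W)%N ->
  block_sum u v w 0 0 W d = ((d.+1 == W)%:R / (poch u W.-1 * poch v W.-1))%:P.
Proof.
elim: W d u v w => // -[_|W IH] d u v w g dW.
  have -> : d = 0%N by case: d dW.
  rewrite /block_sum big_ord1 /= /lagrange_coef !big_ord0 big_mkcond big_ord1 eqxx !mulr1.
  by rewrite invr1 scale1r !nhahn0 !comp_polyC !mulr1 !poch0 mulr1 divr1.
have [[hu hv hw] _ _] := g; have g' := generic_shift g.
(* Removing the first or the last index expresses S_1(x+1) and S_1(x) as S_0(x+1) plus equal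
   constants, so S_1 has period 1. *)
have S1E : block_sum u v w 0 0 W.+2 1 = ((block_sum u v w 0 0 W.+2 1).[0])%:P.
  apply: poly_periodic => x.
  have -> : (block_sum u v w 0 0 W.+2 1).[x] = (block_sum u v w 0 0 W.+2 1).[x + 1 - 1].
    by rewrite addrK.
  rewrite block_sum_drop_first // block_sum_drop_last // !IH // !hornerC; congr (_ + _).
  case: W {IH dW} => [|W] /=; last by rewrite !mul0r.
  rewrite !poch0 /dual_param !add0n; have e2 (q : K) : 2 - q - 2 = - q by ring.
  by field; rewrite !e2 !oppr_eq0 !nonint_neq0.
(* S_0 differs from S_1 by a constant, so it is constant; at 0 every polynomial is 1 and only the
   sum of the Lagrange weights is left. *)
have S0E : block_sum u v w 0 0 W.+2 0 = 0.
  have S0C x : (block_sum u v w 0 0 W.+2 0).[x] = (block_sum u v w 0 0 W.+2 0).[0].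
    have := block_sum_drop_first 0 0 W.+1 0 x g; have := block_sum_drop_first 0 0 W.+1 0 0 g.
    rewrite S1E IH // !hornerC => e1 e2.
    by rewrite e1 in e2; apply: (addIr _ (esym e2)).
  apply: poly_natP => n; rewrite S0C horner0 horner_block_sum -[RHS](lagrange_coef_sum W.+2 g).
  by apply: eq_bigr => i _; rewrite addr0 oppr0 !nhahn_at0 !mulr1.
elim: d dW => [|d IHd] dW; first by rewrite S0E mul0r.
apply: poly_natP => n.
rewrite block_sum_drop_first // IHd 1?ltnW // IH // !hornerC.
rewrite [d.+1 == _]eqn_leq [(_ <= d.+1)%N]leqNgt dW andbF mul0r add0r eqSS /=.
rewrite !pochSl !invfM; ring.
Qed.

Definition pairing_value a b c A B C : {poly K} :=
  (gauge_const a (B + C) * gauge_const b (A + C) * gauge_const c (A + B)) *: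
  (gauge a (B + C) * gauge b (A + C) * gauge c (A + B)).

Lemma pairing_value_swapl a b c A B C : pairing_value a b c A B C = pairing_value b a c B A C.
Proof.
rewrite /pairing_value (addnC A B); congr (_ *: (_ * _)); last exact: mulrC.
by congr (_ * _); apply: mulrC.
Qed.

Lemma pairing_value_swapr a b c A B C : pairing_value a b c A B C = pairing_value a c b A C B.
Proof. by rewrite /pairing_value (addnC B C); congr (_ *: _); apply: mulrAC. Qed.

Lemma polyXaddC_neq0 x : 'X + x%:P != 0.
Proof. by rewrite -size_poly_eq0 size_XaddC. Qed.

Lemma gaugeSl a n : gauge a n.+1 = ('X + (a - 1)%:P) * gauge (a + 1) n.
Proof.
rewrite /gauge pochSl -addrA -[in 'X + (_ + 1)]polyC1 -polyCD.
by congr (_ * poch ('X + _%:P) _); ring.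
Qed.

Lemma gauge_constS a n : nonint a -> gauge_const a n.+1 = gauge_const (a + 1) n / a.
Proof.
move=> ha; rewrite /gauge_const pochSl subrK addrK.
have a1 : a - 1 != 0 by exact: nonint_neq0 (nonintBn 1 ha).
by field; rewrite a1 poch_nonint // nonint_neq0.
Qed.

Lemma pairing_value_step a b c A B C : generic a b c ->
  (a * b)^-1 *: (('X + (a - 1)%:P) * ('X + (b - 1)%:P)
                 * pairing_value (a + 1) (b + 1) c A B C) = pairing_value a b c A B C.+1.
Proof.
case=> -[ha hb hc] _ _; rewrite /pairing_value !addnS !gaugeSl !gauge_constS //.
rewrite -scalerAr scalerA; congr (_ *: _); last by ring.
by field; rewrite !nonint_neq0.
Qed.

(** Quantified over all generic parameters because each removal of an index shifts them. *)
Definition pairing_spec A B C := forall a b c d, generic a b c ->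
  (d < A + B + C)%N ->
  pairing a b c A B C d = (d.+1 == A + B + C)%N%:R *: pairing_value a b c A B C.

Lemma pairing_spec_swapl A B C : pairing_spec A B C -> pairing_spec B A C.
Proof.
move=> P a b c d g; rewrite (addnC B A) => dm.
by rewrite pairing_swapl (P _ _ _ _ (generic_swapl g) dm) [in RHS]pairing_value_swapl.
Qed.

Lemma pairing_spec_swapr A B C : pairing_spec A B C -> pairing_spec A C B.
Proof.
move=> P a b c d g; rewrite addnAC => dm.
by rewrite pairing_swapr (P _ _ _ _ (generic_swapr g) dm) [in RHS]pairing_value_swapr.
Qed.

Lemma pairing_spec_pure C : pairing_spec 0 0 C.
Proof.
move=> a b c d g dC; rewrite /pairing /block_pairing block_sum_pure //.
have -> : block_sum a c b 0 C 0 d = 0 by rewrite /block_sum big_ord0.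
have -> : block_sum b c a 0 C 0 d = 0 by rewrite /block_sum big_ord0.
rewrite !mulr0 !scaler0 !addr0 /pairing_value !addn0 !add0n /gauge /gauge_const !poch0 !mulr1.
case: eqP => [<-|_]; last by rewrite mul0r polyC0 mulr0 scaler0 scale0r.
have [[ha hb hc] _ _] := g.
rewrite scale1r [X in _ *: X = _]mulrC mul_polyC scalerA !pochSl; congr (_ *: _).
rewrite !subrK /=.
have a1 : a - 1 != 0 by exact: nonint_neq0 (nonintBn 1 ha).
have b1 : b - 1 != 0 by exact: nonint_neq0 (nonintBn 1 hb).
by field; rewrite !poch_nonint ?a1 ?b1.
Qed.

(** Removing an index from family [c] or from family [b] gives two recursions for T_d with the same
    inhomogeneous term. *)
Lemma pairing_spec_mixed A B C :
  pairing_spec A B.+1 C -> pairing_spec A B C.+1 -> pairing_spec A B.+1 C.+1.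
Proof.
move=> PB PC a b c d g; rewrite !(addnS, addSn) => dm.
have step e : (e <= A + B + C)%N -> pairing a b c A B.+1 C.+1 e.+1 =
    ('X + (a + e%:R)%:P) * ('X + (b + e%:R)%:P) * pairing a b c A B.+1 C.+1 e
    + (e.+1 == (A + B + C).+1)%N%:R *: pairing_value a b c A B.+1 C.+1.
  rewrite -ltnS => le; have eS : (A + B.+1 + C)%N = (A + B + C).+1 by lia.
  rewrite (pairing_step _ _ _ _ g) (PB _ _ _ _ (generic_shift g)) eS //.
  congr (_ + _); rewrite -(pairing_value_step _ _ _ g) -scalerAr !scalerA.
  by congr (_ *: _); apply: mulrC.
have step' e : (e <= A + B + C)%N -> pairing a b c A B.+1 C.+1 e.+1 =
    ('X + (a + e%:R)%:P) * ('X + (c + e%:R)%:P) * pairing a b c A B.+1 C.+1 e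
    + (e.+1 == (A + B + C).+1)%N%:R *: pairing_value a b c A B.+1 C.+1.
  have g' := generic_swapr g.
  rewrite -ltnS => le; have eS : (A + C.+1 + B)%N = (A + B + C).+1 by lia.
  rewrite !(pairing_swapr a b c) (pairing_step _ _ _ _ g').
  rewrite (pairing_spec_swapr PC (generic_shift g')) eS //.
  congr (_ + _); rewrite (pairing_value_swapr a b c) -(pairing_value_step _ _ _ g').
  by rewrite -scalerAr !scalerA; congr (_ *: _); apply: mulrC.
(* The difference of the two recursions at 0 is (x+a)(c-b) T_0 = 0 up to sign. *)
have h0 : pairing a b c A B.+1 C.+1 0 = 0.
  have := step 0%N (leq0n _); rewrite (step' 0%N (leq0n _)) => /addIr/eqP.
  rewrite -subr_eq0 -mulrBl -mulrBr => /eqP; rewrite !addr0.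
  rewrite opprD addrACA subrr add0r -polyCB => /eqP.
  have [_ [_ _ hbc] _] := g.
  have cb0 : c - b != 0 by rewrite -oppr_eq0 opprB nonint_neq0.
  rewrite !mulf_eq0 polyC_eq0 (negPf cb0) orbF.
  by rewrite (negPf (polyXaddC_neq0 _)) => /eqP.
elim: d dm => [|d IHd] dm; first by rewrite h0 scale0r.
rewrite step // IHd 1?ltnW // [d.+1 == _]ltn_eqF ?scale0r ?mulr0 ?add0r //.
Qed.

Lemma pairingP A B C : pairing_spec A B C.
Proof.
have [m] := ubnP (A + B + C); elim: m A B C => // m IH A B C.
case: A => [|A]; case: B => [|B]; case: C => [|C]; rewrite ?addSn ?addnS => lem.
- exact: pairing_spec_pure.
- exact: pairing_spec_pure.
- exact/pairing_spec_swapr/pairing_spec_pure.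
- by apply: pairing_spec_mixed; apply: IH; lia.
- exact/pairing_spec_swapl/pairing_spec_swapr/pairing_spec_pure.
- by apply: pairing_spec_swapl; apply: pairing_spec_mixed; apply: IH; lia.
- by apply/pairing_spec_swapr/pairing_spec_swapl/pairing_spec_mixed; apply: IH; lia.
- by apply: pairing_spec_mixed; apply: IH; lia.
Qed.

End Pairing.

(** * Complementary minors *)

Section SequenceDeterminants.
Variables (R : comNzRingType) (T : eqType) (x0 : T).
Implicit Types (E : T -> nat -> R) (s t : seq T) (w : T -> R).

(** Rows are given by a list, so that splitting and reordering them are operations on lists. *)
Definition seqdet E n s : R := \det (\matrix_(i < n, j < n) E (nth x0 s i) j).

Lemma det_row_perm n (p : 'S_n) (A : 'M[R]_n) :
  \det (row_perm p A) = (-1) ^+ p * \det A.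
Proof. by rewrite row_permE det_mulmx det_perm. Qed.

Lemma seqdet_perm E n s t : size t = n -> perm_eq s t ->
  exists b : bool, seqdet E n s = (-1) ^+ b * seqdet E n t.
Proof.
move=> st pst; pose tt : n.-tuple T := tcast st (in_tuple t).
have et : t = tt by rewrite val_tcast.
have /tuple_permP[p es] : perm_eq s tt by rewrite -et.
exists p; rewrite /seqdet -det_row_perm; congr (\det _).
apply/matrixP => i j; rewrite !mxE es (nth_map i) ?size_enum_ord //.
by rewrite nth_ord_enum (tnth_nth x0) -et.
Qed.

Lemma det_rev_weighted E w n s : size s = n -> exists b : bool,
  \det (\matrix_(i < n, r < n) (w (nth x0 s r) * E (nth x0 s r) (rev_ord i)))
  = (-1) ^+ b * (\prod_(r <- s) w r) * seqdet E n s.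
Proof.
move=> sn; pose p := perm (@rev_ord_inj n); exists p.
set M := \matrix_(_, _) _.
have -> : M = row_perm p
    (diag_mx (\row_r w (nth x0 s r)) *m \matrix_(i, j) E (nth x0 s i) j)^T.
  apply/matrixP => i r; rewrite !mxE (bigD1 r) //= big1 => [|k kr].
    by rewrite !mxE eqxx mulr1n addr0 permE.
  by rewrite !mxE eq_sym (negPf kr) mulr0n mul0r.
rewrite det_row_perm det_tr det_mulmx det_diag mulrA; congr (_ * _ * _).
rewrite (big_nth x0) sn big_mkord; apply: eq_bigr => i _; by rewrite mxE.
Qed.

(* Jacobi's complementary minors: the matrix of E with its columns reversed,
   times the block matrix (F_s 0; F_t 1), is block upper triangular. *)
Lemma seqdet_complement (F E : T -> nat -> R) w (c : R) k k' s t :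
  size s = k -> size t = k' ->
  (forall i j, (i + j < k + k')%N ->
     \sum_(r <- s ++ t) w r * F r j * E r i
       = ((i + j).+1 == k + k')%N%:R * c) ->
  exists b : bool,
    (\prod_(r <- s ++ t) w r) * seqdet E (k + k') (s ++ t) * seqdet F k s =
    (-1) ^+ b * c ^+ k * (\prod_(r <- t) w r) * seqdet E k' t.
Proof.
move=> ss st orth.
have sst : size (s ++ t) = (k + k')%N by rewrite size_cat ss st.
have [b1 e1] := det_rev_weighted E w sst.
have [b2 e2] := det_rev_weighted E w st.
pose P := \matrix_(i < k + k', r < k + k')
  (w (nth x0 (s ++ t) r) * E (nth x0 (s ++ t) r) (rev_ord i)).
pose B := block_mx (\matrix_(i < k, j < k) F (nth x0 s i) j) 0
  (\matrix_(i < k', j < k) F (nth x0 t i) j) 1%:M.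
have nl i : (i < k)%N -> nth x0 (s ++ t) i = nth x0 s i.
  by move=> ik; rewrite nth_cat ss ik.
have nr i : nth x0 (s ++ t) (k + i) = nth x0 t i.
  by rewrite nth_cat ss ltnNge leq_addr /= addKn.
have S (A : T -> R) : \sum_(r <- s ++ t) A r =
    \sum_(r < k) A (nth x0 s r) + \sum_(r < k') A (nth x0 t r).
  by rewrite big_cat /= !(big_nth x0) ss st !big_mkord.
have PB : P *m B = block_mx
    (\matrix_(i < k, j < k)
       \sum_(r <- s ++ t) w r * F r j * E r ((k + k') - i.+1)%N)
    (ursubmx P) 0
    (\matrix_(i < k', r < k') (w (nth x0 t r) * E (nth x0 t r) (rev_ord i))).
  rewrite -[P in LHS]submxK /B mulmx_block !mulmx0 !mulmx1 !add0r.
  congr block_mx; apply/matrixP => i j; rewrite !mxE.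
  - rewrite S; congr (_ + _); apply: eq_bigr => r _.
      by rewrite !mxE /= nl // mulrAC.
    by rewrite !mxE /= nr mulrAC.
  (* In the lower left block the two indices add up to at most k + k' - 2, where the pairing
     vanishes. *)
  - have lt_i := ltn_ord i; have lt_j := ltn_ord j.
    have lt : (k + k' - (k + i).+1 + j < k + k')%N by lia.
    have := orth _ _ lt; rewrite S (_ : _ == _ = false) ?mul0r; last first.
      by apply/negbTE; lia.
    move=> e0; rewrite -[RHS]e0; congr (_ + _); apply: eq_bigr => r _.
      by rewrite !mxE /= nl // mulrAC.
    by rewrite !mxE /= nr mulrAC.
  - by rewrite /= nr -addnS subnDl.
have dB : \det B = seqdet F k s by rewrite det_lblock det1 mulr1.
have : \det P * \det B =
    c ^+ k * ((-1) ^+ b2 * \prod_(r <- t) w r * seqdet E k' t).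
  rewrite -det_mulmx PB det_ublock e2; congr (_ * _).
  (* In the upper left block the indices add up to k + k' - 1 on the diagonal, giving [c], and to
     less below it, giving 0. *)
  rewrite -det_tr det_trig.
    rewrite (eq_bigr (fun=> c)) ?prodr_const ?card_ord // => i _.
    have lt_i := ltn_ord i.
    rewrite !mxE orth; last by lia.
    by rewrite (_ : _ == _) ?mul1r //; lia.
  apply/is_trig_mxP => i j ij; have lt_j := ltn_ord j.
  rewrite !mxE orth; last by lia.
  by rewrite (_ : _ == _ = false) ?mul0r //; apply/negbTE; lia.
rewrite e1 dB => e; exists (b1 (+) b2).
transitivity ((-1) ^+ b1 * ((-1) ^+ b1 * (\prod_(r <- s ++ t) w r)
    * seqdet E (k + k') (s ++ t) * seqdet F k s)).
  by rewrite -!(mulrA ((-1) ^+ b1)) signrMK.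
by rewrite e signr_addb; ring.
Qed.

End SequenceDeterminants.

(** * Rows of the Casorati matrices *)

Lemma poch_reflect (R : comNzRingType) (y : R) n :
  poch (- y) n = (-1) ^+ n * poch (y - n%:R + 1) n.
Proof.
elim: n y => [|n IH] y; first by rewrite !poch0 mulr1.
rewrite pochSl (_ : - y + 1 = - (y - 1)); last by ring.
rewrite IH pochS exprS.
rewrite (_ : y - 1 - n%:R + 1 = y - n.+1%:R + 1); last by ring.
by rewrite (_ : y - n.+1%:R + 1 + n%:R = y); ring.
Qed.

Section Rows.
Variable K : numFieldType.
Implicit Types (a b c u v w x y : K) (A B C U V W d n : nat).

(** The value at 0 of the Hahn polynomial, normalized to 1 in [nhahn]. *)
Definition hahn_scale u v n : K := poch u n * poch v n / n`!%:R.

Lemma hahn_scale_neq0 u v n : nonint u -> nonint v -> hahn_scale u v n != 0.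
Proof.
move=> hu hv; rewrite /hahn_scale !mulf_neq0 ?poch_nonint // invr_neq0 //.
by rewrite pnatr_eq0 -lt0n fact_gt0.
Qed.

Lemma hahn_nhahn u v w n : nonint u -> nonint v ->
  hahn (u - 1) (v - w) (- v) n = hahn_scale u v n *: nhahn u v w n.
Proof.
move=> hu hv; rewrite /hahn /nhahn /hahn_scale !scaler_sumr; apply: eq_bigr => j _.
rewrite !scalerA; congr (_ *: _).
rewrite opprK subrK (_ : n%:R + (u - 1) + (v - w) + 1 = n%:R + u + v - w);
  last by ring.
have le : (j <= n)%N by rewrite -ltnS.
have eD (q : K) : poch q n = poch q j * poch (q + j%:R) (n - j) by rewrite -pochD subnKC.
rewrite /nhahn_coef (eD u) (eD v).
have jf : (j`!%:R : K) != 0 by rewrite pnatr_eq0 -lt0n fact_gt0.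
have nf : (n`!%:R : K) != 0 by rewrite pnatr_eq0 -lt0n fact_gt0.
by field; rewrite jf nf !poch_nonint.
Qed.

Definition hahn_row u v w n j : {poly K} :=
  poch ('X + u%:P) j * poch ('X + v%:P) j
  * (hahn (u - 1) (v - w) (- v) n \Po ('X + (j%:R)%:P)).

Lemma horner_hahn_row u v w n j x : nonint u -> nonint v -> (hahn_row u v w n j).[x] =
  poch (x + u) j * poch (x + v) j * (hahn_scale u v n * (nhahn u v w n).[x + j%:R]).
Proof.
move=> hu hv; rewrite /hahn_row hahn_nhahn // !hornerM !horner_poch horner_comp.
by rewrite hornerZ !hornerD !hornerX !hornerC.
Qed.

(** The series is symmetric in its lower parameters; this matches the parameters of the F_3 rows
    with those in [trio_row]. *)
Lemma hahn_sym u v w n :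
  hahn (u - 1) (v - w) (- v) n = hahn (v - 1) (u - w) (- u) n.
Proof.
rewrite /hahn; congr (_ *: _); apply: eq_bigr => j _; congr (_ *: _).
rewrite !opprK !subrK; congr (_ / _).
rewrite (_ : n%:R + (u - 1) + (v - w) + 1 = n%:R + (v - 1) + (u - w) + 1);
  last by ring.
by rewrite -!mulrA; do 2!congr (_ * _); apply: mulrC.
Qed.

(** The Lagrange weight adapted to unnormalized Hahn polynomials in both rows; the polynomial part
    is the prefactor of [block_pairing] at d = 0. *)
Definition weight u v w U V W n : {poly K} :=
  (gauge_const w (U + V) * lagrange_coef u v w U V W n
   / (hahn_scale u v n
      * hahn_scale (dual_param u (V + W)) (dual_param v (U + W)) (W.-1 - n))) *:
  (('X + (u - 1)%:P) * ('X + (v - 1)%:P) * gauge w (U + V)).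

(** After reflecting the dual factor, both sides split (x-i+u-1)_(i+M), at i and at M. *)
Lemma poch_dual_param x u M i :
  poch (x - i%:R + (u - 1)) i * poch (x + (u - 1)) M =
  poch (x - i%:R + (u - 1)) M * ((-1) ^+ i * poch (- x + dual_param u M) i).
Proof.
rewrite (_ : - x + dual_param u M = - (x + u + M%:R - 2)); last by rewrite /dual_param; ring.
rewrite poch_reflect signrMK.
rewrite (_ : x + u + M%:R - 2 - i%:R + 1 = x - i%:R + (u - 1) + M%:R); last by ring.
rewrite (_ : x + (u - 1) = x - i%:R + (u - 1) + i%:R); last by ring.
by rewrite -!pochD addnC.
Qed.

Lemma poch_split x u i j :
  poch (x - i%:R + (u - 1)) (i + j).+1 =
  poch (x - i%:R + (u - 1)) i * ((x + (u - 1)) * poch (x + u) j).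
Proof.
rewrite -addnS pochD pochSl; congr (_ * (_ * poch _ _)); ring.
Qed.

Lemma horner_gauge q M x : (gauge q M).[x] = poch (x + (q - 1)) M.
Proof. by rewrite horner_poch hornerD hornerX hornerC. Qed.

(** Entry [i] of a dual row is taken at -(x-i) and entry [j] of a row at (x-i)+(i+j). Hence the sum
    is the share of T_(i+j) at x-i, up to the gauges at x and x-i. *)
Lemma block_rows u v w U V W i j : generic u v w ->
  (\sum_(n < W) weight u v w U V W n * hahn_row u v w n j
     * (hahn_row (dual_param u (V + W)) (dual_param v (U + W)) (dual_param w (U + V))
          (W.-1 - n) i \Po - 'X))
  * ((gauge u (V + W) * gauge v (U + W) * gauge w (U + V)) \Po ('X - i%:R%:P))
  = gauge u (V + W) * gauge v (U + W) * gauge w (U + V)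
    * (block_pairing u v w U V W (i + j) \Po ('X - i%:R%:P)).
Proof.
move=> g; have [[hu hv hw] _ _] := g.
have [[hu' hv' hw'] _ _] := generic_dual_param (V + W) (U + W) (U + V) g.
apply: poly_natP => k; set x := k%:R.
have H2 (p q : {poly K}) y : (p * q).[y] = p.[y] * q.[y] by exact: hornerM.
have H3 (p q r : {poly K}) y : (p * q * r).[y] = p.[y] * q.[y] * r.[y].
  by rewrite !hornerM.
have HX : ('X - i%:R%:P).[x] = x - i%:R by rewrite hornerD hornerX hornerN hornerC.
have HW n : (weight u v w U V W n).[x] =
  (gauge_const w (U + V) * lagrange_coef u v w U V W n
   / (hahn_scale u v n
      * hahn_scale (dual_param u (V + W)) (dual_param v (U + W)) (W.-1 - n))) *
  ((x + (u - 1)) * (x + (v - 1)) * poch (x + (w - 1)) (U + V)).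
  by rewrite hornerZ H3 horner_gauge !hornerD hornerX !hornerC.
rewrite !H2 !horner_comp HX !H3 horner_block_pairing !horner_gauge horner_block_sum horner_sum.
rewrite mulr_suml !mulr_sumr.
apply: eq_bigr => n _.
have -> : x - i%:R + (i + j)%N%:R = x + j%:R by ring.
have -> : - (x - i%:R) = - x + i%:R by ring.
rewrite H3 HW horner_comp !horner_hahn_row // hornerN hornerX.
have e1 := poch_dual_param x u (V + W) i; have e2 := poch_dual_param x v (U + W) i.
rewrite !poch_split.
have eu := hahn_scale_neq0 n hu hv; have eu' := hahn_scale_neq0 (W.-1 - n) hu' hv'.
set E1 := hahn_scale u v _ in eu *; set E2 := hahn_scale _ _ _ in eu' *.
set p1 := poch (- x + dual_param u _) i in e1 *.
set p2 := poch (- x + dual_param v _) i in e2 *.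
set p3 := poch (x - i%:R + (u - 1)) i in e1 *.
set p4 := poch (x - i%:R + (v - 1)) i in e2 *.
set q1 := poch (x + (u - 1)) _ in e1 *.
set q2 := poch (x + (v - 1)) _ in e2 *.
set q3 := poch (x - _ + (u - 1)) _ in e1 *.
set q4 := poch (x - _ + (v - 1)) _ in e2 *.
(* The signs of the two reflections cancel. *)
have e : p3 * q1 * (p4 * q2) = q3 * q4 * p1 * p2.
  rewrite e1 e2; transitivity (((-1) ^+ i * (-1) ^+ i) * (q3 * q4 * p1 * p2)).
    by ring.
  by rewrite -expr2 sqrr_sign mul1r.
rewrite -/(gauge_const w (U + V)).
set h := gauge_const _ _; set l := lagrange_coef _ _ _ _ _ _ _.
set P := (nhahn u v w n).[_]; set P' := (nhahn _ _ _ _).[_].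
set r := poch _ (U + V); set r' := poch _ (U + V).
transitivity (h * l * ((x + (u - 1)) * (x + (v - 1)) * r) *
   (poch (x + u) j * poch (x + v) j * P * P') * r' * (q3 * q4 * p1 * p2)).
  by field; rewrite eu eu'.
by rewrite -e; ring.
Qed.

Implicit Types (r : nat * nat).

(* A row is coded by (s, n), with s = 0, 1, 2 for F_1, F_2, F_3 and n the degree. *)
Definition trio_row a b c r j : {poly K} :=
  match r.1 with
  | 0%N => hahn_row a b c r.2 j
  | 1%N => hahn_row a c b r.2 j
  | _ => hahn_row b c a r.2 j
  end.

Definition trio_weight a b c A B C r : {poly K} :=
  match r.1 with
  | 0%N => weight a b c A B C r.2
  | 1%N => weight a c b A C B r.2
  | _ => weight b c a B C A r.2
  end.

Definition flip A B C r : nat * nat :=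
  (r.1, (match r.1 with 0 => C | 1 => B | _ => A end).-1 - r.2)%N.

Definition trio_rows (s1 s2 s3 : seq nat) : seq (nat * nat) :=
  [seq (0%N, f) | f <- s1] ++ [seq (1%N, f) | f <- s2]
  ++ [seq (2%N, f) | f <- s3].

Definition full_rows A B C := trio_rows (iota 0 C) (iota 0 B) (iota 0 A).

Definition dual_row a b c A B C r i : {poly K} :=
  trio_row (dual_param a (B + C)) (dual_param b (A + C)) (dual_param c (A + B))
    (flip A B C r) i
    \Po - 'X.

Lemma gauge_neq0 q n : gauge q n != 0 :> {poly K}.
Proof.
apply/prodf_neq0 => i _; rewrite -addrA -polyC_natr -polyCD.
exact: polyXaddC_neq0.
Qed.

(** [pairing_value] is a constant multiple of the gauge product, so the gauges at x-i cancel and the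
    value is the same for all [i], as complementary minors require. *)
Lemma trio_rows_pairing a b c A B C i j : generic a b c -> (i + j < A + B + C)%N ->
  \sum_(r <- full_rows A B C)
     trio_weight a b c A B C r * trio_row a b c r j * dual_row a b c A B C r i =
  ((i + j).+1 == A + B + C)%N%:R * pairing_value a b c A B C.
Proof.
move=> g ij.
pose X0 := gauge a (B + C) * gauge b (A + C) * gauge c (A + B).
have X0' : X0 \Po ('X - i%:R%:P) != 0.
  rewrite comp_poly2_eq0 ?size_XsubC //.
  by rewrite /X0 !mulf_neq0 // gauge_neq0.
apply: (mulIf X0'); rewrite !big_cat /= !big_map !mulrDl.
have big_iota n (F : nat -> {poly K}) : \sum_(f <- iota 0 n) F f = \sum_(f < n) F f.
  by rewrite -[in iota _ _](subn0 n) -/(index_iota 0 n) big_mkord.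
rewrite !big_iota /dual_row /trio_row /trio_weight /flip /=.
have e0 := block_rows A B C i j g.
have e1 := block_rows A C B i j (generic_swapr g).
have e2 := block_rows B C A i j (generic_swapr (generic_swapl g)).
rewrite [(C + B)%N]addnC in e1; rewrite [(B + A)%N]addnC [(C + A)%N]addnC in e2.
have x1 : gauge a (B + C) * gauge c (A + B) * gauge b (A + C) = X0.
  by rewrite /X0 mulrAC.
have x2 : gauge b (A + C) * gauge c (A + B) * gauge a (B + C) = X0.
  by rewrite /X0 mulrC mulrA.
rewrite x1 in e1; rewrite x2 in e2; rewrite -/X0 in e0.
rewrite e0 e1 e2 -!mulrDr -!comp_polyD addrA -/(pairing a b c A B C (i + j)).
rewrite (pairingP g ij) comp_polyZ /pairing_value -/X0 !comp_polyZ.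
case: eqP => _; last by rewrite !scale0r mulr0 !mul0r.
by rewrite !scale1r mul1r -scalerAr -scalerAl.
Qed.

Lemma det_casorati a b c F1 F2 F3 :
  \det (casorati_hahn_mx F1 F2 F3 (a - 1) (b - c) (- b)) =
  seqdet (0, 0)%N (trio_row a b c) (#|` F1| + #|` F2| + #|` F3|)
    (trio_rows (sort leq F1) (sort leq F2) (sort leq F3)).
Proof.
rewrite /seqdet; congr (\det _); apply/matrixP => i j.
have s1 := size_sort leq F1; have s2 := size_sort leq F2.
have s3 := size_sort leq F3.
rewrite [RHS]mxE /trio_rows /casorati_hahn_mx.
have ea : a - 1 + 1 = a by rewrite subrK.
have eb : - - b = b by rewrite opprK.
have ec : - (b - c) - - b = c by ring.
case: (split_ordP i) => {}i ->; last first.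
  rewrite col_mxEd mxE /= catA nth_cat size_cat !size_map s1 s2.
  rewrite ltnNge leq_addr /= addKn (nth_map 0%N) ?s3 // /trio_row /=.
  rewrite ec eb /hahn_row [in RHS]hahn_sym; congr (_ * _ * (hahn _ _ _ _ \Po _)) => //.
  by ring.
rewrite col_mxEu; case: (split_ordP i) => {}i ->.
  rewrite col_mxEu mxE /= nth_cat size_map s1 ltn_ord (nth_map 0%N) ?s1 //.
  by rewrite /trio_row /= ea eb.
rewrite col_mxEd mxE /= nth_cat size_map s1 ltnNge leq_addr /= addKn.
rewrite nth_cat size_map s2 ltn_ord (nth_map 0%N) ?s2 // /trio_row /= ea ec /hahn_row.
by congr (_ * _ * (hahn _ _ _ _ \Po _)); ring.
Qed.

End Rows.

(** * The involution on index sets as reflection and complement *)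

Section Complements.
Implicit Types (F G : {fset nat}) (A B C n : nat).

(** The involution with a free bound [n] in place of max F + 1; for empty F it yields the full set
    of indices below [n]. *)
Definition coflip n F : {fset nat} :=
  ([fset m in iota 0 n] `\` [fset (n.-1 - f)%N | f in F])%fset.

Definition bounded n F := forall f, f \in F -> (f < n)%N.

Lemma in_coflip n F f :
  (f \in coflip n F) = (f < n)%N && (f \notin [fset (n.-1 - f)%N | f in F])%fset.
Proof. by rewrite !inE mem_iota andbC. Qed.

Lemma coflip_bounded n F : bounded n (coflip n F).
Proof. by move=> f; rewrite in_coflip => /andP[]. Qed.

Lemma perm_coflip n F : bounded n F ->
  perm_eq (sort leq F ++ [seq (n.-1 - f)%N | f <- sort leq (coflip n F)])
          (iota 0 n).
Proof.
move=> bF; apply: uniq_perm; last first.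
- move=> x; rewrite mem_cat mem_sort mem_iota /= add0n.
  apply/orP/idP => [[/bF //|/mapP[f]]|xn].
    by rewrite mem_sort in_coflip => /andP[fn _] ->; lia.
  case xF: (x \in F); [by left | right]; apply/mapP.
  exists (n.-1 - x)%N; last by lia.
  rewrite mem_sort in_coflip; apply/andP; split; first by lia.
  apply/imfsetP => -[y /= yF e]; have := bF _ yF.
  move=> yn; have exy : x = y by lia.
  by rewrite exy yF in xF.
- exact: iota_uniq.
rewrite cat_uniq sort_uniq fset_uniq /= map_inj_in_uniq ?sort_uniq ?fset_uniq.
  rewrite andbT; apply/hasPn => _ /mapP[f + ->].
  rewrite !mem_sort in_coflip => /andP[fn /imfsetP nf]; apply/negP => /= fF.
  by apply: nf; exists (n.-1 - f)%N => //=; lia.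
by move=> x y; rewrite !mem_sort !in_coflip => /andP[xn _] /andP[yn _]; lia.
Qed.

Lemma card_coflip n F : bounded n F -> (#|` coflip n F| = n - #|` F|)%N.
Proof.
move=> /perm_coflip/perm_size.
rewrite size_cat size_map !size_sort size_iota.
by move=> /(congr1 (subn^~ #|` F|)); rewrite /= addKn.
Qed.

Lemma card_bounded n F : bounded n F -> (#|` F| <= n)%N.
Proof.
move=> /perm_coflip/perm_size; rewrite size_cat size_map !size_sort size_iota.
by move=> e; rewrite -[leqRHS]e leq_addr.
Qed.

Lemma perm_trio_rows A B C F1 F2 F3 : bounded C F1 -> bounded B F2 -> bounded A F3 ->
  perm_eq (trio_rows (sort leq F1) (sort leq F2) (sort leq F3)
           ++ map (flip A B C) (trio_rows (sort leq (coflip C F1))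
                (sort leq (coflip B F2)) (sort leq (coflip A F3))))
          (full_rows A B C).
Proof.
move=> /perm_coflip p1 /perm_coflip p2 /perm_coflip p3.
have f k n s : (flip A B C \o pair k) =1 (pair k \o (fun f => n.-1 - f)%N) ->
    [seq flip A B C r | r <- [seq (k, f) | f <- s]] =
    [seq (k, f) | f <- [seq (n.-1 - f)%N | f <- s]].
  by move=> e; rewrite -!map_comp; apply: eq_map.
rewrite /trio_rows !map_cat (f 0%N C) // (f 1%N B) // (f 2%N A) //.
move: p1 p2 p3 => /(perm_map (pair 0%N))/seq.permP p1 /(perm_map (pair 1%N))/seq.permP p2.
move=> /(perm_map (pair 2%N))/seq.permP p3; apply/seq.permP => P.
rewrite /full_rows /trio_rows !count_cat -p1 -p2 -p3 !map_cat !count_cat.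
by rewrite [LHS]addnACA; congr (_ + _)%N; rewrite addnACA.
Qed.

Lemma flipK A B C F1 F2 F3 : bounded C F1 -> bounded B F2 -> bounded A F3 ->
  {in trio_rows (sort leq F1) (sort leq F2) (sort leq F3),
   involutive (flip A B C)}.
Proof.
move=> b1 b2 b3 r; rewrite !mem_cat => /or3P[] /mapP[f];
  rewrite mem_sort => fF ->; rewrite /flip /=; congr (_, _).
- by have := b1 _ fF; lia.
- by have := b2 _ fF; lia.
- by have := b3 _ fF; lia.
Qed.

Lemma size_trio_rows s1 s2 s3 :
  size (trio_rows s1 s2 s3) = (size s1 + size s2 + size s3)%N.
Proof. by rewrite !size_cat !size_map addnA. Qed.

(** This is max F + 1 as a natural number, with 0 matching the convention that the empty set has
    maximum -1. *)
Definition fcount F : nat := if F == fset0 then 0 else (nmax F).+1.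

Lemma bounded_fcount F : bounded (fcount F) F.
Proof.
move=> f fF; rewrite /fcount; case: eqP => [F0|_]; first by rewrite F0 in fF.
by rewrite ltnS /nmax; apply: (leq_bigmax_seq (F := id)).
Qed.

Lemma invol_coflip F : invol F = coflip (fcount F) F.
Proof.
rewrite /invol /coflip /fcount; case: eqP => [->|//].
by apply/fsetP => x; rewrite !inE andbF.
Qed.

Lemma fmax_fcount (K : numFieldType) F :
  (fmax F)%:~R = (fcount F)%:R - 1 :> K.
Proof.
rewrite /fmax /fcount; case: eqP => _; first by rewrite sub0r.
by rewrite -natr1 addrK.
Qed.

End Complements.

(** * Generic parameters *)

Section GenericProportionality.
Variable K : numFieldType.
Implicit Types (a b c u v w x y q : K) (A B C U V W d n M k : nat).
Implicit Types (F : {fset nat}).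

Lemma eqp_sign n (p q : {poly K}) : p = (-1) ^+ n * q -> p %= q.
Proof.
move=> ->; apply/eqpf_eq; exists ((-1) ^+ n); first by rewrite signr_eq0.
by rewrite -mul_polyC rmorphXn /= polyCN polyC1.
Qed.

Lemma comp_poch (p q : {poly K}) n : poch p n \Po q = poch (p \Po q) n.
Proof.
elim: n => [|n IH]; first by rewrite !poch0 comp_polyC.
by rewrite !pochS comp_polyM IH comp_polyD -polyC_natr comp_polyC.
Qed.

(** Up to sign, the reflected dual factor is (x+q+k)_(M-1-k), which continues (x+q)_k. *)
Lemma poch_dual_param_eqp q M k : (k < M)%N ->
  (poch ('X + (dual_param q M)%:P) (M - k.+1) \Po - 'X) * poch ('X + q%:P) k
  %= poch ('X + q%:P) M.-1.
Proof.
move=> kM; rewrite comp_poch comp_polyD comp_polyX comp_polyC.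
have -> : - 'X + (dual_param q M)%:P = - ('X + (q + M%:R - 2)%:P).
  by rewrite opprD -polyCN /dual_param; congr (_ + _%:P); ring.
rewrite poch_reflect -mulrA.
have -> : 'X + (q + M%:R - 2)%:P - (M - k.+1)%:R + 1 = 'X + q%:P + k%:R.
  rewrite -!polyC_natr -polyC1 -!addrA -polyCN -!polyCD natrB //.
  by congr (_ + _%:P); ring.
apply: (eqp_sign (n := (M - k.+1)%N)); congr (_ * _).
by rewrite mulrC -pochD; congr poch; lia.
Qed.

(** The k largest factors of the dual product pair with the factors of [casorati_den1 q k], each
    pair giving (x+q)_(M-1). *)
Lemma den1_dual_param q M k : (k <= M)%N ->
  (casorati_den1 (dual_param q M) M \Po - 'X) * casorati_den1 q k
  %= poch ('X + q%:P) M.-1 ^+ k * (casorati_den1 (dual_param q M) (M - k) \Po - 'X).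
Proof.
rewrite !casorati_den1E; elim: k => [|k IH] kM.
  by rewrite big_ord0 expr0 subn0 mulr1 mul1r eqpxx.
rewrite big_ord_recr /= mulrA (eqp_ltrans (eqp_mulr _ (IH (ltnW kM)))).
rewrite -(subnSK kM) big_ord_recr /= comp_polyM exprSr -!mulrA.
apply: eqp_mull; rewrite [X in _ %= X]mulrC; apply: eqp_mull.
exact: poch_dual_param_eqp.
Qed.

Lemma comp_polyNX_eq0 (p : {poly K}) : (p \Po - 'X == 0) = (p == 0).
Proof. by rewrite comp_poly2_eq0 // size_polyN size_polyX. Qed.

Lemma poch_neq0 u n : poch ('X + u%:P) n != 0.
Proof. by have := gauge_neq0 (u + 1) n; rewrite /gauge addrK. Qed.

Lemma den1_neq0 u n : casorati_den1 u n != 0.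
Proof.
by rewrite casorati_den1E; apply/prodf_neq0 => i _; apply: poch_neq0.
Qed.

Lemma lagrange_coef_neq0 u v w U V W n : generic u v w -> lagrange_coef u v w U V W n != 0.
Proof.
case=> -[hu hv hw] [_ huw hvw] [hs _ _]; rewrite invr_neq0 //.
apply: mulf_neq0; first apply: mulf_neq0; apply/prodf_neq0 => l.
- rewrite eq_sym => ln; apply: mulf_neq0; first by rewrite subr_eq0 eqr_nat.
  apply: nonint_neq0.
  have -> : n%:R + l%:R + u + v - w = u + v - w + (n + l)%:R by ring.
  exact: nonintDn.
- move=> _; apply: mulf_neq0; apply: nonint_neq0.
    by apply: (nonint_shift (z := v - w) (k := n%:Z - l%:Z)) => //; ring.
  by apply: (nonint_shift (z := u) (k := n%:Z + l%:Z)) => //; ring.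
- move=> _; apply: mulf_neq0; apply: nonint_neq0.
    by apply: (nonint_shift (z := u - w) (k := n%:Z - l%:Z)) => //; ring.
  by apply: (nonint_shift (z := v) (k := n%:Z + l%:Z)) => //; ring.
Qed.

Lemma gauge_const_neq0 q n : nonint q -> gauge_const q n != 0.
Proof.
move=> hq; have hq1 := nonintBn 1 hq.
by rewrite /gauge_const mulf_neq0 ?invr_neq0 ?poch_nonint ?nonint_neq0.
Qed.

Lemma gauge_pred q n : (0 < n)%N ->
  gauge q n = ('X + (q - 1)%:P) * poch ('X + q%:P) n.-1.
Proof. by case: n => // n _; rewrite gaugeSl /gauge addrK. Qed.

Lemma weight_eqp u v w U V W n : generic u v w ->
  weight u v w U V W n
  %= ('X + (u - 1)%:P) * ('X + (v - 1)%:P) * gauge w (U + V).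
Proof.
move=> g; have [[hu hv hw] _ _] := g.
have [[hu' hv' hw'] _ _] := generic_dual_param (V + W) (U + W) (U + V) g.
rewrite /weight eqp_scale //; apply: mulf_neq0.
  by rewrite mulf_neq0 ?gauge_const_neq0 ?lagrange_coef_neq0.
by rewrite invr_neq0 // mulf_neq0 // hahn_scale_neq0.
Qed.

(** Up to a constant, the quotient of [pairing_value] by the weight of a row of [full_rows]. *)
Definition trio_factor a b c A B C (r : nat * nat) : {poly K} :=
  let g q M := poch ('X + q%:P) M.-1 in
  match r.1 with
  | 0%N => g a (B + C)%N * g b (A + C)%N
  | 1%N => g a (B + C)%N * g c (A + B)%N
  | _ => g b (A + C)%N * g c (A + B)%N
  end.

Lemma pairing_value_eqp a b c A B C : generic a b c -> pairing_value a b c A B C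
  %= gauge a (B + C) * gauge b (A + C) * gauge c (A + B).
Proof.
case=> -[ha hb hc] _ _; rewrite /pairing_value eqp_scale //.
by apply: mulf_neq0; [apply: mulf_neq0|]; apply: gauge_const_neq0.
Qed.

Lemma pairing_value_factor a b c A B C r : generic a b c -> r \in full_rows A B C ->
  pairing_value a b c A B C %= trio_weight a b c A B C r * trio_factor a b c A B C r.
Proof.
move=> g; rewrite (eqp_ltrans (pairing_value_eqp _ _ _ g)) !mem_cat.
case/or3P => /mapP[f]; rewrite mem_iota /= add0n => fn ->.
- rewrite /trio_weight /trio_factor /= (eqp_rtrans (eqp_mulr _ (weight_eqp _ _ _ _ g))).
  rewrite (@gauge_pred a) ?(@gauge_pred b); try lia.
  by apply: eqpW; ring.
- have e := weight_eqp A C B f (generic_swapr g).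
  rewrite /trio_weight /trio_factor /= (eqp_rtrans (eqp_mulr _ e)).
  rewrite (@gauge_pred a) ?(@gauge_pred c); try lia.
  by apply: eqpW; ring.
- have e := weight_eqp B C A f (generic_swapr (generic_swapl g)).
  rewrite /trio_weight /trio_factor /= (eqp_rtrans (eqp_mulr _ e)).
  rewrite (@gauge_pred b) ?(@gauge_pred c); try lia.
  by apply: eqpW; rewrite [gauge a (B + C)]lock; ring.
Qed.

Lemma eqp_prod_seq (I : eqType) (s : seq I) (f g : I -> {poly K}) :
  (forall r, r \in s -> f r %= g r) -> \prod_(r <- s) f r %= \prod_(r <- s) g r.
Proof.
elim: s => [|r s IH] h; first by rewrite !big_nil eqpxx.
rewrite !big_cons (eqp_ltrans (eqp_mulr _ (h r _))) ?mem_head //.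
by apply/eqp_mull/IH => r' rs; apply: h; rewrite inE rs orbT.
Qed.

Lemma prod_trio_factor a b c A B C s1 s2 s3 :
  \prod_(r <- trio_rows s1 s2 s3) trio_factor a b c A B C r =
  poch ('X + a%:P) (B + C).-1 ^+ (size s1 + size s2)
  * poch ('X + b%:P) (A + C).-1 ^+ (size s1 + size s3)
  * poch ('X + c%:P) (A + B).-1 ^+ (size s2 + size s3).
Proof.
rewrite !big_cat !big_map /trio_factor /= !big_const_seq !count_predT.
by rewrite !iter_mulr_1 !exprMn !exprD; ring.
Qed.

Definition casorati_abc a b c F1 F2 F3 : {poly K} :=
  casorati_hahn F1 F2 F3 (a - 1) (b - c) (- b).

Definition dual_casorati a b c A B C G1 G2 G3 : {poly K} :=
  casorati_abc (dual_param a (B + C)) (dual_param b (A + C)) (dual_param c (A + B))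
    G1 G2 G3 \Po - 'X.

Lemma casorati_hahn_den_abc a b c F1 F2 F3 :
  casorati_hahn_den F1 F2 F3 (a - 1) (b - c) (- b) =
  casorati_den1 a (#|` F1| + #|` F2|) * casorati_den1 b (#|` F1| + #|` F3|)
  * casorati_den1 c (#|` F2| + #|` F3|).
Proof.
have ec : - (b - c) - - b = c by ring.
by rewrite /casorati_hahn_den subrK ec opprK.
Qed.

Lemma casorati_seqdet a b c F1 F2 F3 :
  seqdet (0, 0)%N (trio_row a b c) (#|` F1| + #|` F2| + #|` F3|)
    (trio_rows (sort leq F1) (sort leq F2) (sort leq F3)) =
  casorati_abc a b c F1 F2 F3
  * (casorati_den1 a (#|` F1| + #|` F2|) * casorati_den1 b (#|` F1| + #|` F3|)
     * casorati_den1 c (#|` F2| + #|` F3|)).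
Proof. by rewrite -casorati_hahn_den_abc casorati_hahnK det_casorati. Qed.

Lemma dual_casorati_seqdet a b c A B C G1 G2 G3 :
  bounded C G1 -> bounded B G2 -> bounded A G3 ->
  seqdet (0, 0)%N (dual_row a b c A B C) (#|` G1| + #|` G2| + #|` G3|)
    (map (flip A B C) (trio_rows (sort leq G1) (sort leq G2) (sort leq G3))) =
  dual_casorati a b c A B C G1 G2 G3
  * ((casorati_den1 (dual_param a (B + C)) (#|` G1| + #|` G2|)
      * casorati_den1 (dual_param b (A + C)) (#|` G1| + #|` G3|)
      * casorati_den1 (dual_param c (A + B)) (#|` G2| + #|` G3|)) \Po - 'X).
Proof.
move=> b1 b2 b3; rewrite /dual_casorati -comp_polyM -casorati_seqdet /seqdet.
rewrite -[RHS](det_map_mx (comp_poly (- 'X))); congr (\det _).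
apply/matrixP => i j; rewrite !mxE.
have lt : (i < size (trio_rows (sort leq G1) (sort leq G2) (sort leq G3)))%N.
  by rewrite size_trio_rows !size_sort.
by rewrite (nth_map (0, 0)%N) // /dual_row (flipK b1 b2 b3) // mem_nth.
Qed.

Lemma bounded0 n : bounded n fset0.
Proof. by move=> f; rewrite inE. Qed.

Lemma coflip0 n : coflip n (coflip n fset0) = fset0.
Proof.
apply: cardfs0_eq; rewrite (card_coflip (@coflip_bounded _ _)).
by rewrite card_coflip ?cardfs0 ?subn0 ?subnn.
Qed.

Lemma card_full n : #|` coflip n fset0| = n.
Proof. by rewrite card_coflip ?cardfs0 ?subn0 //; apply: bounded0. Qed.

Lemma eqp_cancel (p1 p2 p3 n1 n2 n3 g1 g2 g3 q1 q2 q3 d e h : {poly K}) :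
  g1 * g2 * g3 != 0 -> q1 * q2 * q3 != 0 ->
  p1 * n1 %= g1 * q1 -> p2 * n2 %= g2 * q2 -> p3 * n3 %= g3 * q3 ->
  d * (p1 * p2 * p3) * (e * (n1 * n2 * n3))
    %= g1 * g2 * g3 * (h * (q1 * q2 * q3)) ->
  d * e %= h.
Proof.
move=> g0 q0 e1 e2 e3 E.
rewrite -(eqp_mul2r _ _ (mulf_neq0 g0 q0)).
have -> : h * (g1 * g2 * g3 * (q1 * q2 * q3)) =
  g1 * g2 * g3 * (h * (q1 * q2 * q3)) by ring.
rewrite -(eqp_rtrans E).
have -> : d * (p1 * p2 * p3) * (e * (n1 * n2 * n3)) =
  d * e * ((p1 * n1) * (p2 * n2) * (p3 * n3)) by ring.
apply: eqp_mull.
have -> : g1 * g2 * g3 * (q1 * q2 * q3) = (g1 * q1) * (g2 * q2) * (g3 * q3).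
  by ring.
rewrite eqp_sym (eqp_ltrans (eqp_mull _ e3)); apply: eqp_mulr.
by rewrite (eqp_ltrans (eqp_mull _ e2)); apply: eqp_mulr.
Qed.

(** Jacobi's theorem for the rows of F and the flipped rows of their [coflip] sets. The weights
    cancel, and the factors left over balance the denominators by [den1_dual_param]. *)
Lemma casorati_dual_full a b c A B C F1 F2 F3 : generic a b c ->
  bounded C F1 -> bounded B F2 -> bounded A F3 ->
  dual_casorati a b c A B C (coflip C fset0) (coflip B fset0) (coflip A fset0)
    * casorati_abc a b c F1 F2 F3
  %= dual_casorati a b c A B C (coflip C F1) (coflip B F2) (coflip A F3).
Proof.
move=> g b1 b2 b3.
have pst := perm_trio_rows b1 b2 b3.
set s := trio_rows _ _ _ in pst; set t' := trio_rows _ _ _ in pst.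
set k := (#|` F1| + #|` F2| + #|` F3|)%N.
set k' := (#|` coflip C F1| + #|` coflip B F2| + #|` coflip A F3|)%N.
have sk : size s = k by rewrite size_trio_rows !size_sort.
have tk : size (map (flip A B C) t') = k'.
  by rewrite size_map size_trio_rows !size_sort.
have kk : (k + k' = A + B + C)%N.
  rewrite -sk -tk -size_cat (perm_size pst) size_trio_rows !size_iota; lia.
have orth i j : (i + j < k + k')%N ->
    \sum_(r <- s ++ map (flip A B C) t')
       trio_weight a b c A B C r * trio_row a b c r j * dual_row a b c A B C r i
    = ((i + j).+1 == k + k')%N%:R * pairing_value a b c A B C.
  by rewrite (perm_big _ pst) /= kk => ij; apply: trio_rows_pairing.
have [e main] := seqdet_complement (0, 0)%N sk tk orth.
have pfull := perm_trio_rows (@bounded0 C) (@bounded0 B) (@bounded0 A).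
rewrite /= in pfull.
set t := map (flip A B C) t' in pst tk orth main *.
have value0 : pairing_value a b c A B C != 0.
  by rewrite -size_poly_eq0 (eqp_size (pairing_value_eqp A B C g)) size_poly_eq0
     !mulf_neq0 // gauge_neq0.
have factor r : r \in s ++ t -> pairing_value a b c A B C
    %= trio_weight a b c A B C r * trio_factor a b c A B C r.
  by rewrite (perm_mem pst); apply: pairing_value_factor.
have weight0 r : r \in s ++ t -> trio_weight a b c A B C r != 0.
  move=> /factor; apply: contraTneq => ->; rewrite mul0r eqp0.
  exact: value0.
have prod0 (l : seq (nat * nat)) : {subset l <= s ++ t} ->
    \prod_(r <- l) trio_weight a b c A B C r != 0.
  by move=> ls; rewrite prodf_seq_neq0; apply/allP => r /ls; apply: weight0.
have {main} : seqdet (0, 0)%N (dual_row a b c A B C) (k + k') (s ++ t)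
      * seqdet (0, 0)%N (trio_row a b c) k s
    %= (\prod_(r <- s) trio_factor a b c A B C r)
       * seqdet (0, 0)%N (dual_row a b c A B C) k' t.
  have W0 : \prod_(r <- s ++ t) trio_weight a b c A B C r != 0 by apply: prod0.
  rewrite -(eqp_mul2l _ _ W0) mulrA main -!mulrA (eqp_ltrans (eqp_sign erefl)).
  (* One factor [pairing_value] is spent on each row of F and split into weight and
     [trio_factor]. *)
  have -> : pairing_value a b c A B C ^+ k = \prod_(r <- s) pairing_value a b c A B C.
    by rewrite big_const_seq count_predT sk -Monoid.iteropE.
  have e1 : \prod_(r <- s) pairing_value a b c A B C %=
      \prod_(r <- s) (trio_weight a b c A B C r * trio_factor a b c A B C r).
    by apply: eqp_prod_seq => r rs; apply: factor; rewrite mem_cat rs.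
  rewrite (eqp_ltrans (eqp_mulr _ e1)) big_split /= [\prod_(r <- s ++ t) _]big_cat /=.
  by apply: eqpW; ring.
(* Reordering all rows exhibits the full determinant as that of the dual data for the full index
   sets. *)
have [e' ->] : exists e' : bool,
    seqdet (0, 0)%N (dual_row a b c A B C) (k + k') (s ++ t) = (-1) ^+ e' *
    seqdet (0, 0)%N (dual_row a b c A B C) (k + k')
      (map (flip A B C) (trio_rows (sort leq (coflip C fset0))
         (sort leq (coflip B fset0)) (sort leq (coflip A fset0)))).
  apply: seqdet_perm.
    by rewrite (perm_size pfull) -(perm_size pst) size_cat sk tk.
  by rewrite (perm_trans pst) // perm_sym.
rewrite -mulrA (eqp_ltrans (eqp_sign erefl)).
have -> : (k + k' = #|` coflip C fset0| + #|` coflip B fset0|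
    + #|` coflip A fset0|)%N by rewrite !card_full kk; lia.
rewrite casorati_seqdet !dual_casorati_seqdet; try exact: coflip_bounded.
rewrite prod_trio_factor !size_sort !card_full !comp_polyM.
rewrite !card_coflip //.
have := card_bounded b1; have := card_bounded b2; have := card_bounded b3.
set k1 := #|` F1|; set k2 := #|` F2|; set k3 := #|` F3| => l3 l2 l1.
have na : (k1 + k2 <= B + C)%N by lia.
have nb : (k1 + k3 <= A + C)%N by lia.
have nc : (k2 + k3 <= A + B)%N by lia.
have := den1_dual_param a na; have := den1_dual_param b nb; have := den1_dual_param c nc.
have -> : (B + C - (k1 + k2) = C - k1 + (B - k2))%N by lia.
have -> : (A + C - (k1 + k3) = C - k1 + (A - k3))%N by lia.
have -> : (A + B - (k2 + k3) = B - k2 + (A - k3))%N by lia.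
rewrite (addnC C B) (addnC C A) (addnC B A).
move=> ec eb ea; apply: eqp_cancel ea eb ec.
  by rewrite !mulf_neq0 ?expf_neq0 ?poch_neq0.
by rewrite !mulf_neq0 ?comp_polyNX_eq0 ?den1_neq0.
Qed.

Lemma casorati_abc0 a b c : casorati_abc a b c fset0 fset0 fset0 = 1.
Proof.
have := casorati_seqdet a b c fset0 fset0 fset0; rewrite /seqdet.
have den0 q : casorati_den1 q (#|` fset0| + #|` fset0|) = 1 :> {poly K}.
  by rewrite casorati_den1E cardfs0 big_ord0.
by rewrite !den0 !mulr1 => <-; rewrite cardfs0 det_mx00.
Qed.

(* For full F_i the right-hand side of [casorati_dual_full] is 1, so the factor of
   the full sets of rows is a nonzero constant. *)
Lemma casorati_dual_generic a b c A B C F1 F2 F3 : generic a b c ->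
  bounded C F1 -> bounded B F2 -> bounded A F3 ->
  casorati_abc a b c F1 F2 F3
  %= dual_casorati a b c A B C (coflip C F1) (coflip B F2) (coflip A F3).
Proof.
move=> g b1 b2 b3; rewrite -(eqp_rtrans (casorati_dual_full g b1 b2 b3)).
have := casorati_dual_full (A := A) (B := B) (C := C) g
  (@coflip_bounded C fset0) (@coflip_bounded B fset0) (@coflip_bounded A fset0).
rewrite !coflip0 /dual_casorati casorati_abc0 comp_polyC -size_poly_eq1 size_mul_eq1.
set p := _ \Po _ => /andP[]; rewrite size_poly_eq1 => p1 _.
by rewrite eqp_sym (eqp_ltrans (eqp_mulr _ p1)) mul1r eqpxx.
Qed.

End GenericProportionality.

(** * Specialization of the parameters *)

Section Specialization.
Variable K : numFieldType.
Implicit Types (a b c x y t : K) (A B C : nat) (F G : {fset nat}).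
Implicit Types (f g : K -> K).

(** Polynomial dependence on the deformation parameter [t], with x fixed at a point. *)
Definition polyfun f := exists p : {poly K}, forall t, f t = p.[t].

Lemma polyfun_const x : polyfun (fun=> x).
Proof. by exists x%:P => t; rewrite hornerC. Qed.

Lemma polyfun_id : polyfun id.
Proof. by exists 'X => t; rewrite hornerX. Qed.

Lemma polyfunD f g : polyfun f -> polyfun g -> polyfun (fun t => f t + g t).
Proof. by move=> [p hp] [q hq]; exists (p + q) => t; rewrite hornerD hp hq. Qed.

Lemma polyfunM f g : polyfun f -> polyfun g -> polyfun (fun t => f t * g t).
Proof. by move=> [p hp] [q hq]; exists (p * q) => t; rewrite hornerM hp hq. Qed.

Lemma polyfunN f : polyfun f -> polyfun (fun t => - f t).
Proof. by move=> [p hp]; exists (- p) => t; rewrite hornerN hp. Qed.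

Lemma polyfun_ext f g : f =1 g -> polyfun f -> polyfun g.
Proof. by move=> e [p hp]; exists p => t; rewrite -e. Qed.

Lemma polyfun_sum (I : Type) (r : seq I) (P : pred I) (f : I -> K -> K) :
  (forall i, polyfun (f i)) -> polyfun (fun t => \sum_(i <- r | P i) f i t).
Proof.
move=> h; elim: r => [|i r IH].
  by apply: polyfun_ext (polyfun_const 0) => t; rewrite big_nil.
case Pi: (P i); last by apply: polyfun_ext IH => t; rewrite big_cons Pi.
by apply: polyfun_ext (polyfunD (h i) IH) => t; rewrite big_cons Pi.
Qed.

Lemma polyfun_prod (I : Type) (r : seq I) (P : pred I) (f : I -> K -> K) :
  (forall i, polyfun (f i)) -> polyfun (fun t => \prod_(i <- r | P i) f i t).
Proof.
move=> h; elim: r => [|i r IH].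
  by apply: polyfun_ext (polyfun_const 1) => t; rewrite big_nil.
case Pi: (P i); last by apply: polyfun_ext IH => t; rewrite big_cons Pi.
by apply: polyfun_ext (polyfunM (h i) IH) => t; rewrite big_cons Pi.
Qed.

Lemma polyfun_poch f n : polyfun f -> polyfun (fun t => poch (f t) n).
Proof.
by move=> h; apply: polyfun_prod => i; apply: polyfunD => //; apply: polyfun_const.
Qed.

Lemma horner_det n (M : 'M[{poly K}]_n) x :
  (\det M).[x] = \det (\matrix_(i, j) (M i j).[x]).
Proof.
rewrite -[LHS]/(horner_eval x (\det M)) -det_map_mx; congr (\det _).
by apply/matrixP => i j; rewrite !mxE.
Qed.

Lemma polyfun_seqdet (T : eqType) (x0 : T) (E : K -> T -> nat -> {poly K}) n s x :
  (forall r j, polyfun (fun t => (E t r j).[x])) ->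
  polyfun (fun t => (seqdet x0 (E t) n s).[x]).
Proof.
move=> h; pose D t := \sum_(p : 'S_n)
   (-1) ^+ p * \prod_(i < n) (E t (nth x0 s i) (p i)).[x].
have eD : D =1 fun t => (seqdet x0 (E t) n s).[x].
  move=> t; rewrite /seqdet horner_det /determinant; apply: eq_bigr => p _.
  by congr (_ * _); apply: eq_bigr => i _; rewrite !mxE.
apply: polyfun_ext eD _; apply: polyfun_sum => p.
apply: polyfunM; first exact: polyfun_const.
by apply: polyfun_prod => i; apply: h.
Qed.

Lemma polyfun_hahn_row f g h n j x : polyfun f -> polyfun g -> polyfun h ->
  polyfun (fun t => (hahn_row (f t) (g t) (h t) n j).[x]).
Proof.
move=> hf hg hh; have cst := polyfun_const.
apply: (@polyfun_ext (fun t => poch (x + f t) j * poch (x + g t) j *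
  (n`!%:R^-1 * \sum_(i < n.+1)
     (poch (- n%:R) i * poch (n%:R + (f t - 1) + (g t - h t) + 1) i
       * poch (- - g t + i%:R) (n - i) * poch (f t - 1 + 1 + i%:R) (n - i)
       / i`!%:R) * poch (- (x + j%:R)) i))).
  move=> t; rewrite /hahn_row !hornerM !horner_poch horner_comp !hornerD !hornerX !hornerC.
  rewrite /hahn hornerZ horner_sum; congr (_ * (_ * _)).
  by apply: eq_bigr => i _; rewrite hornerZ horner_poch hornerN hornerX.
by repeat first [exact: cst | assumption | apply: polyfun_sum => ?
  | apply: polyfunM | apply: polyfun_poch | apply: polyfunD | apply: polyfunN].
Qed.

Lemma polyfun_trio_row f g h r j x : polyfun f -> polyfun g -> polyfun h ->
  polyfun (fun t => (trio_row (f t) (g t) (h t) r j).[x]).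
Proof.
by move=> hf hg hh; rewrite /trio_row; case: r.1 => [|[|_]]; apply: polyfun_hahn_row.
Qed.

Lemma polyfun_den1 f n x : polyfun f ->
  polyfun (fun t => (casorati_den1 (f t) n).[x]).
Proof.
move=> hf; apply: (@polyfun_ext (fun t => \prod_(m < n) poch (x + f t) m)).
  move=> t; rewrite casorati_den1E horner_prod; apply: eq_bigr => m _.
  by rewrite horner_poch hornerD hornerX hornerC.
apply: polyfun_prod => m; apply: polyfun_poch; apply: polyfunD => //.
exact: polyfun_const.
Qed.

(** Two integral values at different [n] would differ by a nonzero integer of absolute value below
    1, because 101 exceeds the absolute value of [l]; so at most one [n] is bad. Whether one exists
    is decided only classically. *)
Lemma eventually_nonint (l : int) y : l != 0 -> (`|l| <= 100)%N ->
  classically (exists m, forall n, (m <= n)%N ->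
    nonint (l%:~R / (n + 101)%N%:R + y)).
Proof.
move=> l0 l100.
move=> P hP.
apply: (@classic_EM (exists n (z : int), l%:~R / (n + 101)%N%:R + y = z%:~R)).
case=> [[n [z e]]|h]; apply: hP; last first.
  by exists 0%N => n _ z; apply/eqP => e; apply: h; exists n, z.
exists n.+1 => n' nn' z'; apply/eqP => e'.
have N0 k : (k + 101)%N%:R != 0 :> K by rewrite pnatr_eq0 addn_eq0 andbF.
have : l * ((n' + 101)%N%:Z - (n + 101)%N%:Z) = (z - z') * ((n + 101)%N%:Z * (n' + 101)%N%:Z).
  apply: (@intr_inj K); rewrite !rmorphM !rmorphB /= -!pmulrn -e -e'.
  move: (N0 n) (N0 n').
  move: ((n + 101)%N%:R) ((n' + 101)%N%:R) => p p' p0 p'0.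
  by field; rewrite p0 p'0.
move=> /(congr1 absz); rewrite !abszM.
have -> : `|(n' + 101)%N%:Z - (n + 101)%N%:Z|%N = (n' - n)%N by lia.
rewrite !absz_nat; have lpos : (0 < `|l|)%N by rewrite absz_gt0.
case: (eqVneq z z') => [->|zz']; first by rewrite subrr mul0n; nia.
have : (0 < `|z - z'|)%N by rewrite absz_gt0 subr_eq0.
move: (`|_|)%N (`|_|)%N lpos l100 => d L; nia.
Qed.

(* The points t = 1/(n+101) are used: each of the nine linear forms in t that
   must avoid the integers takes an integral value for at most one such n. *)
Lemma generic_density a b c f : polyfun f ->
  (forall t, generic (a + t) (b + 3 * t) (c + 9 * t) -> f t = 0) ->
  f 0 = 0.
Proof.
case=> p hp vanish; apply/eqP.
(* The slopes below are those of the nine forms of [generic] along the direction (1, 3, 9), for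
   which none is zero. *)
have ev (l : int) y := @eventually_nonint l y.
apply: (ev 1 a) => // -[m1 h1]; apply: (ev 3 b) => // -[m2 h2].
apply: (ev 9 c) => // -[m3 h3]; apply: (ev (-2) (a - b)) => // -[m4 h4].
apply: (ev (-8) (a - c)) => // -[m5 h5]; apply: (ev (-6) (b - c)) => // -[m6 h6].
apply: (ev (-5) (a + b - c)) => // -[m7 h7].
apply: (ev 7 (a + c - b)) => // -[m8 h8].
apply: (ev 11 (b + c - a)) => // -[m9 h9].
set m := (m1 + m2 + m3 + m4 + m5 + m6 + m7 + m8 + m9)%N.
suff p0 : p = 0 by rewrite hp p0 horner0.
pose pt n : K := ((m + n) + 101)%N%:R^-1.
have root_pt n : p.[pt n] = 0.
  rewrite -hp; apply: vanish; rewrite /pt; set k := (m + n)%N; set s := _^-1.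
  have sh (l : int) y z : nonint (l%:~R / (k + 101)%N%:R + y) ->
      z = l%:~R * s + y -> nonint z by move=> + ->.
  do 2!split.
  - by apply: (sh _ _ _ (h1 k _)); [lia | ring].
  - by apply: (sh _ _ _ (h2 k _)); [lia | ring].
  - by apply: (sh _ _ _ (h3 k _)); [lia | ring].
  - by apply: (sh _ _ _ (h4 k _)); [lia | ring].
  - by apply: (sh _ _ _ (h5 k _)); [lia | ring].
  - by apply: (sh _ _ _ (h6 k _)); [lia | ring].
  - by apply: (sh _ _ _ (h7 k _)); [lia | ring].
  - by apply: (sh _ _ _ (h8 k _)); [lia | ring].
  - by apply: (sh _ _ _ (h9 k _)); [lia | ring].
apply/eqP/negPn/negP => p0.
have := @max_poly_roots _ p [seq pt n | n <- iota 0 (size p)] p0.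
rewrite size_map size_iota ltnn => H; suff: false by []; apply: H.
  by apply/allP => _ /mapP[n _ ->]; rewrite /root root_pt.
rewrite map_inj_uniq ?iota_uniq // => n n' /invr_inj/eqP.
by rewrite eqr_nat eqn_add2r eqn_add2l => /eqP.
Qed.

(** The factor of proportionality may degenerate at special parameters, so it is eliminated by
    taking values at two points. The denominators [n] and [n'] enter because the undivided
    determinants are the ones visibly polynomial in the parameters. *)
Lemma casorati_dual_minors a b c A B C F1 F2 F3 x y :
  bounded C F1 -> bounded B F2 -> bounded A F3 ->
  let D := casorati_abc a b c F1 F2 F3 in
  let D' := dual_casorati a b c A B C (coflip C F1) (coflip B F2) (coflip A F3) in
  let n := casorati_den1 a (#|` F1| + #|` F2|)
    * casorati_den1 b (#|` F1| + #|` F3|) * casorati_den1 c (#|` F2| + #|` F3|) in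
  let n' := (casorati_den1 (dual_param a (B + C)) (#|` coflip C F1| + #|` coflip B F2|)
    * casorati_den1 (dual_param b (A + C)) (#|` coflip C F1| + #|` coflip A F3|)
    * casorati_den1 (dual_param c (A + B)) (#|` coflip B F2| + #|` coflip A F3|))
    \Po - 'X in
  ((D * n).[x] * (D' * n').[y]) * (n.[y] * n'.[x])
  = ((D * n).[y] * (D' * n').[x]) * (n.[x] * n'.[y]).
Proof.
move=> b1 b2 b3.
pose al t := a + t; pose be t := b + 3 * t; pose ga t := c + 9 * t.
have pal : polyfun al by apply: polyfunD (polyfun_const _) polyfun_id.
have pbe : polyfun be.
  by apply: polyfunD (polyfun_const _) _; apply: polyfunM (polyfun_const _) polyfun_id.
have pga : polyfun ga.
  by apply: polyfunD (polyfun_const _) _; apply: polyfunM (polyfun_const _) polyfun_id.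
have pdual f M : polyfun f -> polyfun (fun t => dual_param (f t) M).
  move=> hf; apply: polyfunD (polyfun_const _).
  by apply: polyfunD (polyfun_const _) _; apply: polyfunN.
pose X t z := (seqdet (0, 0)%N (trio_row (al t) (be t) (ga t))
  (#|` F1| + #|` F2| + #|` F3|)
  (trio_rows (sort leq F1) (sort leq F2) (sort leq F3))).[z].
pose X' t z := (seqdet (0, 0)%N (trio_row (dual_param (al t) (B + C))
    (dual_param (be t) (A + C)) (dual_param (ga t) (A + B)))
  (#|` coflip C F1| + #|` coflip B F2| + #|` coflip A F3|)
  (trio_rows (sort leq (coflip C F1)) (sort leq (coflip B F2))
     (sort leq (coflip A F3)))).[- z].
pose n t z := (casorati_den1 (al t) (#|` F1| + #|` F2|)).[z]
  * (casorati_den1 (be t) (#|` F1| + #|` F3|)).[z]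
  * (casorati_den1 (ga t) (#|` F2| + #|` F3|)).[z].
pose n' t z :=
  (casorati_den1 (dual_param (al t) (B + C)) (#|` coflip C F1| + #|` coflip B F2|)).[- z]
  * (casorati_den1 (dual_param (be t) (A + C))
       (#|` coflip C F1| + #|` coflip A F3|)).[- z]
  * (casorati_den1 (dual_param (ga t) (A + B))
       (#|` coflip B F2| + #|` coflip A F3|)).[- z].
pose Z t := (X t x * X' t y) * (n t y * n' t x)
   - (X t y * X' t x) * (n t x * n' t y).
have pX z : polyfun (X^~ z).
  by apply: polyfun_seqdet => r j; apply: polyfun_trio_row.
have pX' z : polyfun (X'^~ z).
  by apply: polyfun_seqdet => r j; apply: polyfun_trio_row; apply: pdual.
have pn z : polyfun (n^~ z).
  by apply: polyfunM; first apply: polyfunM; apply: polyfun_den1.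
have pn' z : polyfun (n'^~ z).
  by apply: polyfunM; first apply: polyfunM; apply: polyfun_den1; apply: pdual.
have pZ : polyfun Z.
  apply: polyfunD; first by do 2!apply: polyfunM.
  by apply: polyfunN; do 2!apply: polyfunM.
have Z0 : Z 0 = 0.
  apply: (@generic_density a b c Z pZ) => t g.
  have /eqpf_eq[k _ e] := casorati_dual_generic g b1 b2 b3.
  have XE z : X t z = k * (casorati_abc (dual_param (al t) (B + C)) (dual_param (be t) (A + C))
      (dual_param (ga t) (A + B)) (coflip C F1) (coflip B F2) (coflip A F3)).[- z]
      * n t z.
    rewrite /X casorati_seqdet /n e hornerM hornerZ horner_comp hornerN hornerX.
    by congr (_ * _); rewrite 2!hornerM.
  have XE' z : X' t z = (casorati_abc (dual_param (al t) (B + C)) (dual_param (be t) (A + C))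
      (dual_param (ga t) (A + B)) (coflip C F1) (coflip B F2) (coflip A F3)).[- z]
      * n' t z.
    rewrite /X' casorati_seqdet /n' hornerM.
    by congr (_ * _); rewrite 2!hornerM.
  by rewrite /Z !XE !XE'; ring.
move=> D D' m m'; apply/eqP; rewrite -subr_eq0; apply/eqP.
rewrite -[RHS]Z0 /Z.
have al0 : al 0 = a by rewrite /al addr0.
have be0 : be 0 = b by rewrite /be mulr0 addr0.
have ga0 : ga 0 = c by rewrite /ga mulr0 addr0.
have nE z : m.[z] = n 0 z by rewrite /m /n al0 be0 ga0 2!hornerM.
have nE' z : m'.[z] = n' 0 z.
  by rewrite /m' /n' al0 be0 ga0 horner_comp 2!hornerM hornerN hornerX.
have XE z : (D * m).[z] = X 0 z by rewrite /X al0 be0 ga0 casorati_seqdet.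
have XE' z : (D' * m').[z] = X' 0 z.
  rewrite /X' al0 be0 ga0 casorati_seqdet /D' /m' /dual_casorati -comp_polyM.
  by rewrite horner_comp hornerN hornerX.
by rewrite !nE !nE' !XE !XE'.
Qed.

End Specialization.

(** * From vanishing minors to equality of monic polynomials *)

Section Normalization.
Variable K : numFieldType.

Lemma ex_nonroot (p : {poly K}) : p != 0 -> exists x, p.[x] != 0.
Proof.
move=> p0; have := @max_poly_roots _ p [seq n%:R | n <- iota 0 (size p)] p0.
rewrite size_map size_iota ltnn map_inj_uniq ?iota_uniq; last first.
  by move=> m n /eqP; rewrite eqr_nat => /eqP.
move=> H; have /allPn[x _ px] : ~~ all (root p) [seq n%:R | n <- iota 0 (size p)].
  by apply/negP => /H/(_ isT).
by exists x.
Qed.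

(** Fixing [y] off the zeros of all four polynomials gives the constant p(y)/q(y). *)
Lemma eqp_minors (p q m m' : {poly K}) : p != 0 -> q != 0 -> m != 0 -> m' != 0 ->
  (forall x y, ((p * m).[x] * (q * m').[y]) * (m.[y] * m'.[x])
     = ((p * m).[y] * (q * m').[x]) * (m.[x] * m'.[y])) ->
  p %= q.
Proof.
move=> p0 q0 m0 m'0 minors.
have [y] : exists y, (p * q * m * m').[y] != 0.
  by apply: ex_nonroot; rewrite !mulf_neq0.
rewrite !hornerM !mulf_eq0 !negb_or => /andP[/andP[/andP[py qy] my] m'y].
apply/eqpf_eq; exists (p.[y] / q.[y]).
  by rewrite mulf_neq0 ?invr_neq0.
apply: (mulIf m0); apply: (mulIf m'0); apply: poly_natP => n.
have := minors n%:R y; rewrite !hornerM hornerZ => e.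
have k0 : q.[y] * m.[y] * m'.[y] != 0 by rewrite !mulf_neq0.
apply: (mulIf k0).
transitivity ((p.[n%:R] * m.[n%:R] * (q.[y] * m'.[y])) * (m.[y] * m'.[n%:R])).
  by ring.
by rewrite e; field.
Qed.

(** Normalizing removes the constant of proportionality; the reflection multiplies the leading
    coefficient by the sign of the degree, which is its own inverse. *)
Lemma normalize_reflect (p q : {poly K}) : q != 0 -> p %= q \Po - 'X ->
  let P := (lead_coef p)^-1 *: p in
  P = (-1) ^+ (size P).-1 *: (((lead_coef q)^-1 *: q) \Po - 'X).
Proof.
move=> q0 /eqpf_eq[k k0 ->] /=.
have sX : size (- 'X : {poly K}) = 2 by rewrite size_polyN size_polyX.
have l0 : lead_coef q != 0 by rewrite lead_coef_eq0.
rewrite lead_coefZ lead_coef_comp ?sX // lead_coefN lead_coefX.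
rewrite comp_polyZ !scalerA.
set s := (-1) ^+ (size q).-1.
have s0 : s != 0 by rewrite signr_eq0.
rewrite size_scale ?size_scale ?size_comp_poly2 ?sX // -/s; last first.
  by rewrite mulf_neq0 ?invr_neq0 // ?mulf_neq0.
have ss : s * s = 1 by rewrite -expr2 sqrr_sign.
congr (_ *: _).
have e : s = s^-1 by apply: (mulfI s0); rewrite ss mulfV.
by rewrite [in RHS]e; field; rewrite k0 l0 s0.
Qed.

End Normalization.

Theorem theorem7p1 (K : numFieldType) (F1 F2 F3 : {fset nat})
    (alpha beta N : K) :
  let alpha' := - alpha - (fmax F1)%:~R - (fmax F2)%:~R - 2 in
  let beta' := - beta - (fmax F1)%:~R + (fmax F2)%:~R in
  let N' := - N + (fmax F1)%:~R + (fmax F3)%:~R in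
  let H := ncasorati_hahn F1 F2 F3 alpha beta N in
  let H' := ncasorati_hahn (invol F1) (invol F2) (invol F3) alpha' beta' N' in
  (casorati_hahn_lead F1 F2 F3 alpha beta N = 0 <->
   casorati_hahn_lead (invol F1) (invol F2) (invol F3) alpha' beta' N' = 0) ->
  H = (-1) ^+ (size H).-1 *: (H' \Po - 'X).
Proof.
move=> alpha' beta' N'; rewrite /ncasorati_hahn /casorati_hahn_lead.
pose a := alpha + 1; pose b := - N; pose c := - beta - N.
set C := fcount F1; set B := fcount F2; set A := fcount F3.
have eD : casorati_hahn F1 F2 F3 alpha beta N = casorati_abc a b c F1 F2 F3.
  rewrite /casorati_abc /a /b /c addrK !opprK (_ : - N - (- beta - N) = beta) //.
  by ring.
have eD' : casorati_hahn (invol F1) (invol F2) (invol F3) alpha' beta' N' =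
    casorati_abc (dual_param a (B + C)) (dual_param b (A + C)) (dual_param c (A + B))
      (coflip C F1) (coflip B F2) (coflip A F3).
  have -> : alpha' = dual_param a (B + C) - 1.
    by rewrite /alpha' !fmax_fcount -/B -/C /dual_param /a natrD; ring.
  have -> : beta' = dual_param b (A + C) - dual_param c (A + B).
    by rewrite /beta' !fmax_fcount -/B -/C /dual_param /b /c !natrD; ring.
  have -> : N' = - dual_param b (A + C).
    by rewrite /N' !fmax_fcount -/A -/C /dual_param /b natrD; ring.
  by rewrite !invol_coflip.
rewrite eD eD'; have minors x y := casorati_dual_minors a b c x y
  (@bounded_fcount F1) (@bounded_fcount F2) (@bounded_fcount F3).
move: minors; rewrite /= -/A -/B -/C /dual_casorati.
set p := casorati_abc _ _ _ _ _ _; set q := casorati_abc _ _ _ _ _ _.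
set m := _ * _ * casorati_den1 _ _; set m' := _ * _ * casorati_den1 _ _ => minors.
(* If both leading coefficients vanish, both sides are the conventional 1, of degree 0 and hence
   with sign 1. *)
case: (eqVneq (lead_coef p) 0) => [p0 [pq _]|p0 [_ pq]].
  by rewrite (pq p0) eqxx size_poly1 expr0 scale1r comp_polyC.
have q0 : lead_coef q != 0 by apply: contraNneq p0 => /pq ->.
rewrite (negPf q0); rewrite !lead_coef_eq0 in p0 q0.
apply: normalize_reflect => //; apply: eqp_minors minors => //.
- by rewrite comp_polyNX_eq0.
- by rewrite !mulf_neq0 ?den1_neq0.
- by rewrite comp_polyNX_eq0 !mulf_neq0 ?den1_neq0.
Qed.
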